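(* Let $\theta\in(0,1)$, $c>0$, and suppose $p_i=c\,i^{-1/\theta}\bigl(1+o(i^{-1/2})\bigr)$ as $i\to\infty$. Let $A$ satisfy the conditions stated in the context and, in addition, $A(t)=0$ for all $t\in[0,\delta]$ for some $\delta\in(0,1)$. Then, as $n\to\infty$, $$\sqrt{\mathbf E R_n}\,\bigl(\widehat\theta_n-\theta\bigr)-\int_0^1 t^{-\theta}Z_n(t)\,dA(t)\ \xrightarrow{\ p\ }\ 0 .$$
   Context: Model: words are drawn one by one, independently, from a countably infinite dictionary $\{1,2,\dots\}$, the $i$-th word being drawn with probability $p_i>0$, $\sum_i p_i=1$. For $j\ge1$, $R_j$ denotes the number of distinct words among the first $j$ draws; $R_0=0$. $[x]$ is the integer part of $x$, and $\log^+x=\max(\log x,0)$ (with $\log^+0=0$). The weight function $A:[0,1]\to\mathbb R$ is the sum of a step function and a piecewise continuously differentiable function on $[0,1]$, and satisfies $\int_0^1\log t\,dA(t)=1$ and $A(0)=A(0+)=A(1)=0$; integrals $\int\cdot\,dA$ are Lebesgue–Stieltjes integrals. The estimator is $\widehat\theta_n=\int_0^1\log^+R_{[nt]}\,dA(t)$. The process $Z_n$ is $Z_n(t)=\dfrac{R_{[nt]}-\mathbf E R_{[nt]}}{\sqrt{\mathbf E R_n}}$, $0\le t\le1$. *)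

(* Defs.v *)
From Stdlib Require Import Reals Lra Lia ZArith Arith List Classical ClassicalEpsilon.
Open Scope R_scope.

Definition seq_lim (u : nat -> R) : R :=
  match excluded_middle_informative (exists l, Un_cv u l) with
  | left H => proj1_sig (constructive_indefinite_description _ H)
  | right _ => 0
  end.

Definition Rint (f : R -> R) (a b : R) : R :=
  match excluded_middle_informative
          (exists v, exists pr : Riemann_integrable f a b, RiemannInt pr = v) with
  | left H => proj1_sig (constructive_indefinite_description _ H)
  | right _ => 0
  end.

(* [PwC1 A m a g dg]: a decomposition witnessing that A is (on [0,1]) the sum of a
   step function and a piecewise C^1 function: 0 = a 0 < a 1 < ... < a m = 1,
   on each open piece (a k, a (k+1)) (k < m) A coincides with g k, and g k is
   continuously differentiable on the closed piece [a k, a (k+1)] with derivative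
   dg k. Values of A at the breakpoints a k are arbitrary (jumps allowed). *)
Definition PwC1 (A : R -> R) (m : nat) (a : nat -> R) (g dg : nat -> R -> R) : Prop :=
  (1 <= m)%nat /\ a 0%nat = 0 /\ a m = 1 /\
  (forall k, (k < m)%nat -> a k < a (S k)) /\
  (forall k, (k < m)%nat -> forall t, a k <= t <= a (S k) ->
       derivable_pt_lim (g k) t (dg k t) /\ continuity_pt (dg k) t) /\
  (forall k, (k < m)%nat -> forall t, a k < t < a (S k) -> A t = g k t).

(* Left / right limits of A at the breakpoint a k, with the conventions
   A(0-) := A(0) and A(1+) := A(1) (the measure dA lives on [0,1]). *)
Definition A_left (A : R -> R) (a : nat -> R) (g : nat -> R -> R) (k : nat) : R :=
  match k with 0%nat => A (a 0%nat) | S j => g j (a k) end.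
Definition A_right (A : R -> R) (m : nat) (a : nat -> R) (g : nat -> R -> R) (k : nat) : R :=
  if Nat.ltb k m then g k (a k) else A (a k).

(* Lebesgue--Stieltjes integral  \int_[0,1] f dA  computed from the decomposition:
   absolutely continuous part  sum_k \int_{a k}^{a(k+1)} f(t) g_k'(t) dt
   plus atoms of mass A(a_k+) - A(a_k-) at the breakpoints. *)
Definition LSint (A : R -> R) (m : nat) (a : nat -> R) (g dg : nat -> R -> R)
  (f : R -> R) : R :=
  (match m with
   | 0%nat => 0
   | S m' => sum_f_R0 (fun k => Rint (fun t => f t * dg k t) (a k) (a (S k))) m'
   end)
  + sum_f_R0 (fun k => f (a k) * (A_right A m a g k - A_left A a g k)) m.

(* A realisation of the first n draws is a list w = [w_1; ...; w_n] of words (>= 1). *)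

Definition Rdist (j : nat) (w : list nat) : nat :=
  length (nodup Nat.eq_dec (firstn j w)).

Definition wprob (p : nat -> R) (w : list nat) : R :=
  fold_right (fun i r => p i * r) 1 w.

Fixpoint words (n K : nat) : list (list nat) :=
  match n with
  | 0%nat => nil :: nil
  | S n' => flat_map (fun w => map (fun i => i :: w) (seq 1 K)) (words n' K)
  end.

Definition trunc_E (p : nat -> R) (n K : nat) (F : list nat -> R) : R :=
  fold_right (fun w r => wprob p w * F w + r) 0 (words n K).

Definition Expect (p : nat -> R) (n : nat) (F : list nat -> R) : R :=
  seq_lim (fun K => trunc_E p n K F).

Definition Prob (p : nat -> R) (n : nat) (E : list nat -> Prop) : R :=
  Expect p n (fun w => if excluded_middle_informative (E w) then 1 else 0).

Definition ER (p : nat -> R) (j : nat) : R :=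
  Expect p j (fun w => INR (Rdist j w)).

Definition floorR (x : R) : nat := Z.to_nat (Int_part x).

Definition logp (x : R) : R := if Rlt_dec 1 x then ln x else 0.

Definition theta_hat (A : R -> R) (m : nat) (a : nat -> R) (g dg : nat -> R -> R)
  (n : nat) (w : list nat) : R :=
  LSint A m a g dg (fun t => logp (INR (Rdist (floorR (INR n * t)) w))).

Definition Zn (p : nat -> R) (n : nat) (t : R) (w : list nat) : R :=
  (INR (Rdist (floorR (INR n * t)) w) - ER p (floorR (INR n * t))) / sqrt (ER p n).

(* Main.v *)
Require Import Defs.
From Stdlib Require Import Reals Lra Lia ZArith Arith List Permutation Classical ClassicalEpsilon.
From Coquelicot Require Import Coquelicot.
Open Scope R_scope.

(** Expectations are limits of sums over words with letters at most [K], whose total mass is [s ^ n]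
    with [s = p 1 + ... + p K < 1]. Variance and Markov's inequality are therefore handled at fixed
    [K]: the variance is computed around the mean of the normalized truncated law, and the limit in
    [K] comes last. At fixed [K] an expectation is a finite sum, so exchanging it with the integral
    is mere linearity.

    The exponent 1/2 in the error of [p] matches the normalization: a relative error o(i^(-1/2))
    summed over i <= x gives o(sqrt x), and sqrt (E R_n) has order sqrt x. Since the bias is
    multiplied by sqrt (E R_n), T(x) = C x + o(x) would not be enough. The value of C is never
    computed: it cancels in E R_[nt] / E R_n.

    When R_[nt] falls far below its mean, only R_[nt] >= 1 is available; this costs a factor log (E
    R_[nt]), absorbed because log V = o(sqrt V). The support [delta, 1] keeps t^(-theta) and E R_n /
    E R_[nt] bounded. *)

(** The weight [A] has total mass [A 1 - A 0 = 0] and [\int log t dA = 1], so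
    [theta_hat - theta] is the integral of [log R_[nt] - log (E R_n) - theta log t].
    A first-order expansion of the logarithm around [E R_[nt]] gives [t^(-theta) Z_n(t)],
    up to a bias of order [log (E R_[nt] / (E R_n t^theta))] and a remainder quadratic in [Z_n].

    For the bias, [E R_n = sum_i (1 - (1 - p_i)^n)] is compared with [T(x) = sum_i phi(x/i)],
    where [phi(u) = 1 - exp (- u^(1/theta))] and [x = (c n)^theta].  Poissonization costs
    [O(sum p_i) = O(1)], and the error [o(i^(-1/2))] in [p_i] costs [o(sqrt x)].  Grouping the
    sum in blocks of [k] terms yields [k T(x) <= T(k x) <= k (T(x) + 1)], whence
    [T(x) = C x + O(1)].  So [E R_n = C x + o(sqrt x)] and the bias is [o((E R_n)^(-1/2))].

    For the remainder, negative correlation of the occupancy indicators gives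
    [Var R_j <= E R_j], hence [E Z_n(t)^2] is bounded uniformly in [t]; integrating over [|dA|]
    and applying Markov's inequality finishes the proof. *)

(** * Sums over words *)

Definition lsum {X : Type} (f : X -> R) (l : list X) : R :=
  fold_right (fun x r => f x + r) 0 l.

Lemma lsum_app {X : Type} (f : X -> R) (l1 l2 : list X) :
  lsum f (l1 ++ l2) = lsum f l1 + lsum f l2.
Proof. induction l1 as [|x l1 IH]; simpl; [ring | rewrite IH; ring]. Qed.

Lemma lsum_flat_map {X Y : Type} (f : Y -> R) (k : X -> list Y) (l : list X) :
  lsum f (flat_map k l) = lsum (fun x => lsum f (k x)) l.
Proof. induction l as [|x l IH]; simpl; [easy | now rewrite lsum_app, IH]. Qed.

Lemma lsum_map {X Y : Type} (f : Y -> R) (k : X -> Y) (l : list X) :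
  lsum f (map k l) = lsum (fun x => f (k x)) l.
Proof. induction l as [|x l IH]; simpl; [easy | now rewrite IH]. Qed.

Lemma lsum_ext {X : Type} (f g : X -> R) (l : list X) :
  (forall x, In x l -> f x = g x) -> lsum f l = lsum g l.
Proof.
  induction l as [|x l IH]; simpl; intros H; [easy|].
  rewrite H, IH; auto.
Qed.

Lemma lsum_le {X : Type} (f g : X -> R) (l : list X) :
  (forall x, In x l -> f x <= g x) -> lsum f l <= lsum g l.
Proof.
  induction l as [|x l IH]; simpl; intros H; [lra|].
  apply Rplus_le_compat; auto.
Qed.

Lemma lsum_plus {X : Type} (f g : X -> R) (l : list X) :
  lsum (fun x => f x + g x) l = lsum f l + lsum g l.
Proof. induction l as [|x l IH]; simpl; [ring | rewrite IH; ring]. Qed.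

Lemma lsum_minus {X : Type} (f g : X -> R) (l : list X) :
  lsum (fun x => f x - g x) l = lsum f l - lsum g l.
Proof. induction l as [|x l IH]; simpl; [ring | rewrite IH; ring]. Qed.

Lemma lsum_scal {X : Type} (r : R) (f : X -> R) (l : list X) :
  lsum (fun x => r * f x) l = r * lsum f l.
Proof. induction l as [|x l IH]; simpl; [ring | rewrite IH; ring]. Qed.

Lemma lsum_const {X : Type} (r : R) (l : list X) :
  lsum (fun _ => r) l = INR (length l) * r.
Proof.
  induction l as [|x l IH]; [simpl; ring|].
  change (length (x :: l)) with (S (length l)); rewrite S_INR; simpl; rewrite IH; ring.
Qed.

Lemma lsum_nonneg {X : Type} (f : X -> R) (l : list X) :
  (forall x, In x l -> 0 <= f x) -> 0 <= lsum f l.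
Proof.
  intros H; replace 0 with (lsum (fun _ : X => 0) l) by (rewrite lsum_const; ring).
  now apply lsum_le.
Qed.

Lemma lsum_exchange {X Y : Type} (f : X -> Y -> R) (l : list X) (l' : list Y) :
  lsum (fun x => lsum (f x) l') l = lsum (fun y => lsum (fun x => f x y) l) l'.
Proof.
  induction l as [|x l IH]; simpl.
  - change (0 = lsum (fun _ : Y => 0) l'); rewrite lsum_const; ring.
  - now rewrite IH, <- lsum_plus.
Qed.

Lemma lsum_Rabs {X : Type} (f : X -> R) (l : list X) :
  Rabs (lsum f l) <= lsum (fun x => Rabs (f x)) l.
Proof.
  induction l as [|x l IH]; simpl; [rewrite Rabs_R0; lra|].
  eapply Rle_trans; [apply Rabs_triang | lra].
Qed.

Lemma lsum_sqr {X : Type} (f : X -> R) (l : list X) :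
  lsum f l * lsum f l = lsum (fun x => lsum (fun y => f x * f y) l) l.
Proof.
  rewrite <- lsum_scal; apply lsum_ext; intros x _; rewrite lsum_scal; ring.
Qed.

Lemma lsum_single (f : nat -> R) (x : nat) (l : list nat) :
  NoDup l -> In x l -> lsum (fun y => if Nat.eq_dec y x then f y else 0) l = f x.
Proof.
  induction l as [|y l IH]; simpl; intros ND Hin; [easy|].
  inversion ND; subst.
  destruct (Nat.eq_dec y x) as [->|Hne].
  - rewrite (lsum_ext _ (fun _ => 0)).
    + rewrite lsum_const; ring.
    + intros z Hz; destruct (Nat.eq_dec z x) as [->|]; [contradiction|easy].
  - destruct Hin as [->|Hin]; [easy|]. rewrite IH; auto; ring.
Qed.

Lemma lsum_remove (f : nat -> R) (x : nat) (l : list nat) :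
  NoDup l -> In x l ->
  lsum (fun y => if Nat.eq_dec y x then 0 else f y) l = lsum f l - f x.
Proof.
  intros ND Hin.
  rewrite <- (lsum_single f x l ND Hin), <- lsum_minus.
  apply lsum_ext; intros y _; destruct (Nat.eq_dec y x); ring.
Qed.

Lemma lsum_member_le (f : nat -> R) (x : nat) (l : list nat) :
  (forall y, In y l -> 0 <= f y) -> NoDup l -> In x l -> f x <= lsum f l.
Proof.
  intros Hf ND Hin.
  assert (0 <= lsum (fun y => if Nat.eq_dec y x then 0 else f y) l).
  { apply lsum_nonneg; intros y Hy; destruct (Nat.eq_dec y x); [lra | auto]. }
  rewrite lsum_remove in H; auto; lra.
Qed.

Lemma lsum_seq_S (f : nat -> R) (K : nat) :
  lsum f (seq 1 (S K)) = lsum f (seq 1 K) + f (S K).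
Proof. rewrite seq_S, lsum_app; simpl; ring. Qed.

Lemma lsum_seq_sum_f_R0 (f : nat -> R) (K : nat) :
  lsum f (seq 1 (S K)) = sum_f_R0 (fun i => f (S i)) K.
Proof.
  induction K as [|K IH]; [simpl; ring|].
  rewrite lsum_seq_S, IH; reflexivity.
Qed.

(** * Factorization of sums over words, and missing words *)

Definition lprod (f : nat -> R) (w : list nat) : R :=
  fold_right (fun i r => f i * r) 1 w.

(** Independence of the draws: the sum factorizes letter by letter. Taking for [f] the weights [p]
    with some letters set to 0 gives the mass of the words that avoid these letters in their first
    [j] draws; the other [n - j] draws contribute a mass that is not 1 under truncation. *)
Lemma lsum_words_lprod (f p : nat -> R) (K n j : nat) :
  (j <= n)%nat ->
  lsum (fun w => lprod f (firstn j w) * lprod p (skipn j w)) (words n K) =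
  lsum f (seq 1 K) ^ j * lsum p (seq 1 K) ^ (n - j).
Proof.
  revert j; induction n as [|n IH]; intros j Hj.
  - replace j with 0%nat by lia; simpl; ring.
  - change (words (S n) K) with
      (flat_map (fun w => map (fun i => i :: w) (seq 1 K)) (words n K)).
    rewrite lsum_flat_map.
    destruct j as [|j].
    + specialize (IH 0%nat ltac:(lia)); simpl in IH; rewrite Nat.sub_0_r in IH.
      rewrite (lsum_ext _ (fun w => lsum p (seq 1 K) * (1 * lprod p w))).
      * rewrite lsum_scal, IH; simpl; ring.
      * intros w _; rewrite lsum_map; simpl.
        rewrite (lsum_ext _ (fun i => lprod p w * p i)) by (intros; ring).
        rewrite lsum_scal; ring.
    + rewrite (lsum_ext _ (fun w => lsum f (seq 1 K) *
                             (lprod f (firstn j w) * lprod p (skipn j w)))).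
      * rewrite lsum_scal, IH by lia; simpl; ring.
      * intros w _; rewrite lsum_map; simpl.
        rewrite (lsum_ext _ (fun i => (lprod f (firstn j w) * lprod p (skipn j w)) * f i))
          by (intros; ring).
        rewrite lsum_scal; ring.
Qed.

Lemma lprod_firstn_skipn (p : nat -> R) (j : nat) (w : list nat) :
  lprod p (firstn j w) * lprod p (skipn j w) = wprob p w.
Proof.
  revert j; induction w as [|x w IH]; intros [|j]; try apply Rmult_1_l.
  change ((p x * lprod p (firstn j w)) * lprod p (skipn j w) = p x * wprob p w).
  rewrite <- (IH j); ring.
Qed.

Lemma wprob_nonneg (p : nat -> R) (n K : nat) (w : list nat) :
  (forall i, (1 <= i)%nat -> 0 < p i) -> In w (words n K) -> 0 <= wprob p w.
Proof.
  intros Hp; revert w; induction n as [|n IH]; simpl; intros w Hw.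
  - destruct Hw as [<-|[]]; simpl; lra.
  - apply in_flat_map in Hw; destruct Hw as [u [Hu Hw]].
    apply in_map_iff in Hw; destruct Hw as [i [<- Hi]].
    apply in_seq in Hi; simpl.
    apply Rmult_le_pos; [left; apply Hp; lia | auto].
Qed.

Lemma words_spec (n K : nat) (w : list nat) :
  In w (words n K) -> length w = n /\ forall i, In i w -> In i (seq 1 K).
Proof.
  revert w; induction n as [|n IH]; simpl; intros w Hw.
  - destruct Hw as [<-|[]]; simpl; split; [easy | intros i []].
  - apply in_flat_map in Hw; destruct Hw as [u [Hu Hw]].
    apply in_map_iff in Hw; destruct Hw as [i [<- Hi]].
    destruct (IH u Hu) as [<- Hin]; split; [easy|].
    intros k [<-|Hk]; auto.
Qed.

(** Absence is used rather than presence because the absence of one or several words is a product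
    over the letters, so [lsum_words_lprod] evaluates its moments. *)
Definition missing (i : nat) (u : list nat) : R :=
  if in_dec Nat.eq_dec i u then 0 else 1.

Lemma length_nodup_missing (l u : list nat) :
  NoDup l -> incl u l ->
  INR (length (nodup Nat.eq_dec u)) = INR (length l) - lsum (fun i => missing i u) l.
Proof.
  intros ND Hu.
  assert (H : forall l', lsum (fun i => missing i u) l' =
    INR (length l') - INR (length (filter (fun i => if in_dec Nat.eq_dec i u then true else false) l'))).
  { induction l' as [|x l' IH]; [simpl; ring|].
    simpl lsum; rewrite IH.
    change (length (x :: l')) with (S (length l')); rewrite S_INR.
    unfold missing; simpl filter; destruct (in_dec Nat.eq_dec x u);
      [change (length (x :: ?q)) with (S (length q))|]; simpl length; try rewrite S_INR; ring. }
  rewrite H.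
  rewrite (Permutation_length (l := nodup Nat.eq_dec u)
    (l' := filter (fun i => if in_dec Nat.eq_dec i u then true else false) l)); [ring|].
  apply NoDup_Permutation.
  - apply NoDup_nodup.
  - now apply NoDup_filter.
  - intros x; rewrite nodup_In, filter_In.
    destruct (in_dec Nat.eq_dec x u); split; intros; auto; try easy.
Qed.

Lemma Rdist_missing (n K j : nat) (w : list nat) :
  In w (words n K) ->
  INR (Defs.Rdist j w) = INR K - lsum (fun i => missing i (firstn j w)) (seq 1 K).
Proof.
  intros Hw; destruct (words_spec n K w Hw) as [_ Hin].
  unfold Defs.Rdist; rewrite (length_nodup_missing (seq 1 K)).
  - now rewrite length_seq.
  - apply seq_NoDup.
  - intros i Hi; apply Hin. rewrite <- (firstn_skipn j w); apply in_or_app; auto.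
Qed.

Lemma lprod_missing (p : nat -> R) (i : nat) (u : list nat) :
  lprod (fun y => if Nat.eq_dec y i then 0 else p y) u = lprod p u * missing i u.
Proof.
  unfold missing; induction u as [|x u IH]; [simpl; ring|].
  simpl lprod; rewrite IH.
  destruct (Nat.eq_dec x i) as [->|Hne].
  - destruct (in_dec Nat.eq_dec i (i :: u)) as [_|Hn]; [ring|]; exfalso; apply Hn; now left.
  - destruct (in_dec Nat.eq_dec i u) as [H|H], (in_dec Nat.eq_dec i (x :: u)) as [H'|H'];
      try ring.
    + exfalso; apply H'; now right.
    + destruct H'; [congruence | contradiction].
Qed.

Lemma trunc_E_missing (p : nat -> R) (n K j i : nat) :
  (j <= n)%nat -> In i (seq 1 K) ->
  trunc_E p n K (fun w => missing i (firstn j w)) =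
  (lsum p (seq 1 K) - p i) ^ j * lsum p (seq 1 K) ^ (n - j).
Proof.
  intros Hj Hi.
  rewrite <- (lsum_remove p i _ (seq_NoDup K 1) Hi), <- lsum_words_lprod by easy.
  apply lsum_ext; intros w _.
  rewrite lprod_missing, <- (lprod_firstn_skipn p j w); ring.
Qed.

Lemma trunc_E_missing2 (p : nat -> R) (n K j i k : nat) :
  (j <= n)%nat -> In i (seq 1 K) -> In k (seq 1 K) -> i <> k ->
  trunc_E p n K (fun w => missing i (firstn j w) * missing k (firstn j w)) =
  (lsum p (seq 1 K) - p i - p k) ^ j * lsum p (seq 1 K) ^ (n - j).
Proof.
  intros Hj Hi Hk Hik.
  rewrite <- (lsum_remove p i _ (seq_NoDup K 1) Hi).
  replace (p k) with ((fun y => if Nat.eq_dec y i then 0 else p y) k)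
    by (simpl; destruct (Nat.eq_dec k i); [congruence|easy]).
  rewrite <- (lsum_remove (fun y => if Nat.eq_dec y i then 0 else p y) k _ (seq_NoDup K 1) Hk).
  rewrite <- lsum_words_lprod by easy.
  apply lsum_ext; intros w _.
  rewrite lprod_missing, lprod_missing, <- (lprod_firstn_skipn p j w); ring.
Qed.

Lemma trunc_E_one (p : nat -> R) (n K : nat) :
  trunc_E p n K (fun _ => 1) = lsum p (seq 1 K) ^ n.
Proof.
  pose proof (lsum_words_lprod p p K n 0 ltac:(lia)) as H.
  rewrite Nat.sub_0_r, Rmult_1_l in H; rewrite <- H.
  apply lsum_ext; intros w _; simpl; unfold lprod, wprob; ring.
Qed.

Lemma trunc_E_plus (p : nat -> R) (n K : nat) (F G : list nat -> R) :
  trunc_E p n K (fun w => F w + G w) = trunc_E p n K F + trunc_E p n K G.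
Proof.
  unfold trunc_E; fold (lsum (fun w => wprob p w * F w) (words n K)).
  fold (lsum (fun w => wprob p w * G w) (words n K)).
  rewrite <- lsum_plus; apply lsum_ext; intros; ring.
Qed.

Lemma trunc_E_scal (p : nat -> R) (n K : nat) (r : R) (F : list nat -> R) :
  trunc_E p n K (fun w => r * F w) = r * trunc_E p n K F.
Proof.
  unfold trunc_E; fold (lsum (fun w => wprob p w * F w) (words n K)).
  rewrite <- lsum_scal; apply lsum_ext; intros; ring.
Qed.

Lemma trunc_E_ext (p : nat -> R) (n K : nat) (F G : list nat -> R) :
  (forall w, In w (words n K) -> F w = G w) -> trunc_E p n K F = trunc_E p n K G.
Proof. intros H; apply lsum_ext; intros w Hw; now rewrite H. Qed.

Lemma trunc_E_le (p : nat -> R) (n K : nat) (F G : list nat -> R) :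
  (forall i, (1 <= i)%nat -> 0 < p i) ->
  (forall w, In w (words n K) -> F w <= G w) -> trunc_E p n K F <= trunc_E p n K G.
Proof.
  intros Hp H; apply lsum_le; intros w Hw.
  apply Rmult_le_compat_l; [now apply (wprob_nonneg p n K) | auto].
Qed.

Lemma trunc_E_lsum {X : Type} (p : nat -> R) (n K : nat) (F : X -> list nat -> R) (l : list X) :
  trunc_E p n K (fun w => lsum (fun x => F x w) l) = lsum (fun x => trunc_E p n K (F x)) l.
Proof.
  unfold trunc_E.
  rewrite (lsum_ext (fun x => fold_right _ 0 _)
             (fun x => lsum (fun w => wprob p w * F x w) (words n K))) by easy.
  rewrite lsum_exchange. apply lsum_ext; intros w _; now rewrite lsum_scal.
Qed.

(** Each indicator of presence is 1 minus an indicator of absence, and it depends on the first [j]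
    letters only; the last factor is the mass of the remaining draws. *)
Lemma trunc_E_Rdist (p : nat -> R) (n K j : nat) :
  (j <= n)%nat ->
  trunc_E p n K (fun w => INR (Defs.Rdist j w)) =
  lsum (fun i => lsum p (seq 1 K) ^ j - (lsum p (seq 1 K) - p i) ^ j) (seq 1 K)
  * lsum p (seq 1 K) ^ (n - j).
Proof.
  intros Hj.
  rewrite (trunc_E_ext _ _ _ _ (fun w => lsum (fun i => 1 + (-1) * missing i (firstn j w)) (seq 1 K))).
  - rewrite trunc_E_lsum, Rmult_comm, <- lsum_scal.
    apply lsum_ext; intros i Hi.
    rewrite trunc_E_plus, trunc_E_one, trunc_E_scal, trunc_E_missing by easy.
    replace n with (n - j + j)%nat at 1 by lia.
    rewrite pow_add; ring.
  - intros w Hw; rewrite (Rdist_missing n K) by easy.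
    rewrite lsum_plus, lsum_const, lsum_scal, length_seq; ring.
Qed.

(** Here [a i] is the probability of missing [i] under the normalized truncated law. The indicators
    are negatively correlated, so only the diagonal of the expanded square survives, and there
    [a i * (1 - a i) <= 1 - a i]. *)
Lemma lsum_missing_var (p : nat -> R) (n K j : nat) (a : nat -> R) :
  (forall i, (1 <= i)%nat -> 0 < p i) ->
  (j <= n)%nat -> (1 <= K)%nat ->
  (forall i, a i = (lsum p (seq 1 K) - p i) ^ j / lsum p (seq 1 K) ^ j) ->
  trunc_E p n K (fun w => lsum (fun i => missing i (firstn j w) - a i) (seq 1 K) ^ 2)
  <= lsum p (seq 1 K) ^ n * lsum (fun i => 1 - a i) (seq 1 K).
Proof.
  intros Hp Hj HK Ha.
  set (s := lsum p (seq 1 K)) in *.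
  assert (Hmem : forall i, In i (seq 1 K) -> 0 < p i <= s).
  { intros i Hi; split; [apply Hp; apply in_seq in Hi; lia|].
    apply lsum_member_le; auto using seq_NoDup.
    intros y Hy; left; apply Hp; apply in_seq in Hy; lia. }
  assert (Hs : 0 < s) by (destruct (Hmem 1%nat); [apply in_seq; lia | lra]).
  assert (Hsj : 0 < s ^ j) by now apply pow_lt.
  assert (Hsn : s ^ n = s ^ j * s ^ (n - j)) by (rewrite <- pow_add; f_equal; lia).
  assert (HM : 0 <= s ^ (n - j)) by (apply pow_le; lra).
  assert (Ha1 : forall i, In i (seq 1 K) -> 0 <= a i <= 1).
  { intros i Hi; destruct (Hmem i Hi); rewrite Ha; split.
    - apply Rle_div_r; [easy|]. rewrite Rmult_0_l; apply pow_le; lra.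
    - apply Rle_div_l; [easy|]. rewrite Rmult_1_l; apply pow_incr; lra. }
  rewrite (trunc_E_ext _ _ _ _ (fun w => lsum (fun i => lsum (fun k =>
    (missing i (firstn j w) - a i) * (missing k (firstn j w) - a k)) (seq 1 K)) (seq 1 K))).
  2:{ intros w _; rewrite <- lsum_sqr; ring. }
  rewrite trunc_E_lsum, <- lsum_scal.
  apply lsum_le; intros i Hi.
  rewrite trunc_E_lsum.
  (* Off-diagonal terms are bounded by 0, diagonal ones by the mean of the presence indicator. *)
  apply Rle_trans with (lsum (fun k => if Nat.eq_dec k i then s ^ n * (1 - a k) else 0) (seq 1 K)).
  2:{ rewrite lsum_single; auto using seq_NoDup; lra. }
  apply lsum_le; intros k Hk.
  assert (HE : trunc_E p n K (fun w => (missing i (firstn j w) - a i) * (missing k (firstn j w) - a k))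
    = trunc_E p n K (fun w => missing i (firstn j w) * missing k (firstn j w)) - s ^ n * a i * a k).
  { rewrite (trunc_E_ext _ _ _ _ (fun w => missing i (firstn j w) * missing k (firstn j w)
       + ((- a i) * missing k (firstn j w) + ((- a k) * missing i (firstn j w) + (a i * a k) * 1))))
      by (intros; ring).
    rewrite 3!trunc_E_plus, 3!trunc_E_scal, trunc_E_one, 2!trunc_E_missing by easy.
    fold s.
    replace ((s - p k) ^ j) with (s ^ j * a k) by (rewrite Ha; field; lra).
    replace ((s - p i) ^ j) with (s ^ j * a i) by (rewrite Ha; field; lra).
    rewrite Hsn; ring. }
  rewrite HE; clear HE.
  destruct (Nat.eq_dec k i) as [->|Hne].
  - rewrite (trunc_E_ext _ _ _ _ (fun w => missing i (firstn j w))).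
    2:{ intros w _; unfold missing; destruct (in_dec _ _ _); ring. }
    rewrite trunc_E_missing by easy; fold s.
    replace ((s - p i) ^ j) with (s ^ j * a i) by (rewrite Ha; field; lra).
    rewrite Hsn. pose proof (Ha1 i Hi).
    assert (0 <= s ^ j * s ^ (n - j) * (1 - a i) ^ 2)
      by (apply Rmult_le_pos; [apply Rmult_le_pos; lra | apply pow2_ge_0]).
    lra.
  - rewrite trunc_E_missing2 by auto; fold s.
    destruct (Hmem i Hi), (Hmem k Hk).
    (* Makes the base [s - p i - p k] nonnegative, as monotonicity of powers requires. *)
    assert (Hik : p i + p k <= s).
    { pose proof (lsum_member_le (fun y => if Nat.eq_dec y i then 0 else p y) k (seq 1 K)) as Hm.
      rewrite lsum_remove in Hm by auto using seq_NoDup. fold s in Hm.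
      destruct (Nat.eq_dec k i); [easy|].
      enough (p k <= s - p i) by lra. apply Hm; auto using seq_NoDup.
      intros y Hy; destruct (Nat.eq_dec y i); [lra|]; left; now apply Hmem. }
    (* Negative correlation: [s * (s - p i - p k) <= (s - p i) * (s - p k)], the difference being
       [p i * p k]. *)
    assert (s ^ j * (s - p i - p k) ^ j <= s ^ j * s ^ j * a i * a k).
    { replace (s ^ j * s ^ j * a i * a k) with ((s - p i) ^ j * (s - p k) ^ j)
        by (rewrite !Ha; field; lra).
      rewrite <- !Rpow_mult_distr; apply pow_incr; nra. }
    assert ((s - p i - p k) ^ j <= s ^ j * a i * a k).
    { apply Rmult_le_reg_l with (s ^ j); lra. }
    rewrite Hsn; nra.
Qed.

(** * Tools for letting the truncation level tend to infinity *)

Lemma seq_lim_unique (u : nat -> R) (l : R) : Un_cv u l -> seq_lim u = l.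
Proof.
  intros H; unfold seq_lim.
  destruct (excluded_middle_informative _) as [He|He].
  - destruct (constructive_indefinite_description _ He) as [l' Hl']; simpl.
    eapply UL_sequence; eauto.
  - exfalso; eauto.
Qed.

(** Valid for convergent and divergent [u] alike: the default value 0 of [seq_lim] also lies in
    [[0, B]]. Hence probabilities can be bounded through their truncations alone. *)
Lemma seq_lim_bounds (u : nat -> R) (B : R) (K0 : nat) :
  0 <= B -> (forall K, (K0 <= K)%nat -> 0 <= u K <= B) -> 0 <= seq_lim u <= B.
Proof.
  intros HB H; unfold seq_lim.
  destruct (excluded_middle_informative _) as [He|He]; [|lra].
  destruct (constructive_indefinite_description _ He) as [l Hl]; simpl.
  split; apply le_epsilon; intros e He'; destruct (Hl e He') as [N HN];
    specialize (HN (N + K0)%nat ltac:(lia)); specialize (H (N + K0)%nat ltac:(lia));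
    unfold Rfunctions.Rdist in HN; apply Rabs_def2 in HN; lra.
Qed.

Lemma pow_sub_le (r q : R) (j : nat) :
  0 <= q <= r -> r <= 1 -> 0 <= r ^ j - (r - q) ^ j <= INR j * q.
Proof.
  intros Hq Hr; induction j as [|j IH]; [simpl; lra|].
  rewrite S_INR; simpl.
  assert (0 <= (r - q) ^ j <= 1).
  { split; [apply pow_le; lra|]. rewrite <- (pow1 j); apply pow_incr; lra. }
  nra.
Qed.

(** Compares the probability of a hit under the full law with its truncated counterpart. The factor
    [q] makes the error summable over the words, and [1 - s] makes the sum vanish as [K] grows. *)
Lemma pow_sub_defect (s q : R) (j : nat) :
  0 <= q <= s -> s <= 1 ->
  0 <= (1 - (1 - q) ^ j) - (s ^ j - (s - q) ^ j) <= INR j * INR j * (1 - s) * q.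
Proof.
  intros Hq Hs; induction j as [|j IH]; [simpl; lra|].
  assert (H1 := pow_sub_le 1 q j ltac:(lra) ltac:(lra)); rewrite pow1 in H1.
  assert (Hd := pow_sub_le (1 - q) (1 - s) j ltac:(lra) ltac:(lra)).
  replace (1 - q - (1 - s)) with (s - q) in Hd by ring.
  rewrite S_INR; simpl.
  pose proof (pos_INR j).
  set (D1 := 1 - (1 - q) ^ j) in *; set (Ds := s ^ j - (s - q) ^ j) in *.
  set (E := (1 - q) ^ j - (s - q) ^ j) in *.
  replace (1 - (1 - q) * (1 - q) ^ j - (s * s ^ j - (s - q) * (s - q) ^ j))
    with ((1 - s) * D1 + s * (D1 - Ds) + q * E) by (unfold D1, Ds, E; ring).
  assert (0 <= (1 - s) * D1 <= (1 - s) * (INR j * q))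
    by (split; [apply Rmult_le_pos|apply Rmult_le_compat_l]; lra).
  assert (0 <= q * E <= q * (INR j * (1 - s)))
    by (split; [apply Rmult_le_pos|apply Rmult_le_compat_l]; lra).
  assert (0 <= s * (D1 - Ds) <= 1 * (INR j * INR j * (1 - s) * q)).
  { split; [apply Rmult_le_pos; lra|]. apply Rmult_le_compat; lra. }
  assert (0 <= (1 - s) * q) by (apply Rmult_le_pos; lra).
  split; [lra|]. nra.
Qed.

(** * Mean and variance of the number of distinct words *)

Definition is_dict (p : nat -> R) : Prop :=
  (forall i, (1 <= i)%nat -> 0 < p i) /\ infinite_sum (fun i => p (S i)) 1.

Lemma dict_cv (p : nat -> R) :
  is_dict p -> Un_cv (fun K => lsum p (seq 1 K)) 1.
Proof.
  intros [_ H] e He; destruct (H e He) as [N HN]; exists (S N).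
  intros [|n] Hn; [lia|]. rewrite lsum_seq_sum_f_R0; apply HN; lia.
Qed.

Lemma dict_mass (p : nat -> R) (K : nat) :
  is_dict p -> 0 <= lsum p (seq 1 K) <= 1.
Proof.
  intros Hd; split.
  - apply lsum_nonneg; intros i Hi; left; apply Hd; apply in_seq in Hi; lia.
  - apply (growing_ineq (fun K => lsum p (seq 1 K))); [|now apply dict_cv].
    intros n; rewrite lsum_seq_S; pose proof (proj1 Hd (S n) ltac:(lia)); lra.
Qed.

Lemma dict_le_mass (p : nat -> R) (i K : nat) :
  is_dict p -> In i (seq 1 K) -> 0 < p i <= lsum p (seq 1 K).
Proof.
  intros Hd Hi; split; [apply Hd; apply in_seq in Hi; lia|].
  apply lsum_member_le; auto using seq_NoDup.
  intros y Hy; left; apply Hd; apply in_seq in Hy; lia.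
Qed.

Lemma dict_le_1 (p : nat -> R) (i : nat) :
  is_dict p -> (1 <= i)%nat -> 0 < p i <= 1.
Proof.
  intros Hd Hi; pose proof (dict_mass p i Hd).
  destruct (dict_le_mass p i i Hd); [apply in_seq; lia | lra].
Qed.

Lemma hit_prob_bounds (p : nat -> R) (i j : nat) :
  is_dict p -> (1 <= i)%nat -> 0 <= 1 - (1 - p i) ^ j <= INR j * p i.
Proof.
  intros Hd Hi; pose proof (dict_le_1 p i Hd Hi).
  pose proof (pow_sub_le 1 (p i) j ltac:(lra) ltac:(lra)) as H1.
  now rewrite pow1 in H1.
Qed.

Lemma hit_sum_growing (p : nat -> R) (j : nat) :
  is_dict p -> Un_growing (fun K => lsum (fun i => 1 - (1 - p i) ^ j) (seq 1 K)).
Proof.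
  intros Hd n; rewrite lsum_seq_S.
  pose proof (hit_prob_bounds p (S n) j Hd ltac:(lia)); lra.
Qed.

Lemma hit_sum_le (p : nat -> R) (j K : nat) :
  is_dict p -> lsum (fun i => 1 - (1 - p i) ^ j) (seq 1 K) <= INR j.
Proof.
  intros Hd; apply Rle_trans with (lsum (fun i => INR j * p i) (seq 1 K)).
  - apply lsum_le; intros i Hi; apply hit_prob_bounds; auto; apply in_seq in Hi; lia.
  - rewrite lsum_scal; pose proof (dict_mass p K Hd); pose proof (pos_INR j); nra.
Qed.

(** The truncated means in the definition of [ER] are squeezed between the partial sums of the hit
    series and the same sums minus [j ^ 2 * (1 - s)]. Both sequences are kept: the series serves the
    asymptotics, the truncated means serve the variance. *)
Lemma ER_cv (p : nat -> R) (j : nat) :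
  is_dict p ->
  Un_cv (fun K => lsum (fun i => 1 - (1 - p i) ^ j) (seq 1 K)) (ER p j) /\
  Un_cv (fun K => lsum (fun i => lsum p (seq 1 K) ^ j - (lsum p (seq 1 K) - p i) ^ j) (seq 1 K))
    (ER p j).
Proof.
  intros Hd.
  set (U := fun K => lsum (fun i => 1 - (1 - p i) ^ j) (seq 1 K)).
  set (G := fun K => lsum (fun i => lsum p (seq 1 K) ^ j - (lsum p (seq 1 K) - p i) ^ j) (seq 1 K)).
  destruct (growing_cv U) as [V HV].
  { now apply hit_sum_growing. }
  { exists (INR j); intros x [K ->]; now apply hit_sum_le. }
  assert (HG : Un_cv G V).
  { apply is_lim_seq_Reals.
    apply is_lim_seq_le_le with (fun K => U K - INR j * INR j * (1 - lsum p (seq 1 K))) U.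
    - intros K; unfold U, G.
      pose proof (dict_mass p K Hd) as Hs.
      set (s := lsum p (seq 1 K)) in *.
      assert (Hi : forall i, In i (seq 1 K) -> 0 <=
        (1 - (1 - p i) ^ j) - (s ^ j - (s - p i) ^ j) <= INR j * INR j * (1 - s) * p i).
      { intros i Hi; pose proof (dict_le_mass p i K Hd Hi).
        fold s in H; apply pow_sub_defect; lra. }
      assert (0 <= lsum (fun i => (1 - (1 - p i) ^ j) - (s ^ j - (s - p i) ^ j)) (seq 1 K)
        <= INR j * INR j * (1 - s) * s).
      { split; [apply lsum_nonneg; intros i Hi'; now apply Hi|].
        change (INR j * INR j * (1 - s) * s) with (INR j * INR j * (1 - s) * lsum p (seq 1 K));
        rewrite <- lsum_scal; apply lsum_le; intros i Hi'; now apply Hi. }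
      rewrite lsum_minus in H.
      assert (0 <= INR j * INR j * (1 - s)).
      { pose proof (pos_INR j); apply Rmult_le_pos; nra. }
      nra.
    - apply is_lim_seq_ext with (fun K => U K + - (INR j * INR j) * (1 + - 1 * lsum p (seq 1 K)));
        [intros; ring|].
      replace V with (V + - (INR j * INR j) * (1 + - 1 * 1)) by ring.
      apply is_lim_seq_plus'; [now apply is_lim_seq_Reals|].
      apply is_lim_seq_mult'; [apply is_lim_seq_const|].
      apply is_lim_seq_plus'; [apply is_lim_seq_const|].
      apply is_lim_seq_mult'; [apply is_lim_seq_const|].
      apply is_lim_seq_Reals; now apply dict_cv.
    - now apply is_lim_seq_Reals. }
  replace (ER p j) with V; [now split|].
  symmetry; apply seq_lim_unique.
  intros e He; destruct (HG e He) as [N HN]; exists N; intros n Hn.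
  rewrite trunc_E_Rdist, Nat.sub_diag, pow_O, Rmult_1_r by easy.
  now apply HN.
Qed.

Lemma ER_ge (p : nat -> R) (j K : nat) :
  is_dict p -> lsum (fun i => 1 - (1 - p i) ^ j) (seq 1 K) <= ER p j.
Proof.
  intros Hd.
  apply (growing_ineq (fun K => lsum (fun i => 1 - (1 - p i) ^ j) (seq 1 K))).
  - now apply hit_sum_growing.
  - now apply ER_cv.
Qed.

(** With [ER_ge], this makes [ER p j] the least upper bound of the partial sums of the hit
    series. *)
Lemma ER_le (p : nat -> R) (j : nat) (B : R) :
  is_dict p -> (forall K, lsum (fun i => 1 - (1 - p i) ^ j) (seq 1 K) <= B) -> ER p j <= B.
Proof.
  intros Hd HB.
  apply (is_lim_seq_le (fun K => lsum (fun i => 1 - (1 - p i) ^ j) (seq 1 K)) (fun _ => B)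
    (ER p j) B HB).
  - apply is_lim_seq_Reals; now apply ER_cv.
  - apply is_lim_seq_const.
Qed.

(** Bias-variance decomposition at level [K]: [vK] is the mean of the normalized truncated law, and
    the cross term vanishes because [Y] is centred. *)
Lemma trunc_E_sqr_dev (p : nat -> R) (n j K : nat) (v : R) :
  is_dict p -> (j <= n)%nat -> (1 <= K)%nat ->
  let s := lsum p (seq 1 K) in
  let vK := lsum (fun i => s ^ j - (s - p i) ^ j) (seq 1 K) / s ^ j in
  trunc_E p n K (fun w => (INR (Defs.Rdist j w) - v) ^ 2) <= vK + (vK - v) ^ 2.
Proof.
  intros Hd Hj HK s vK.
  assert (Hs : 0 < s).
  { destruct (dict_le_mass p 1 K Hd); [apply in_seq; lia | unfold s; lra]. }
  assert (Hs1 : s <= 1) by (apply dict_mass; easy).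
  assert (Hsj : 0 < s ^ j) by now apply pow_lt.
  set (a := fun i => (s - p i) ^ j / s ^ j).
  assert (HvK : vK = lsum (fun i => 1 - a i) (seq 1 K)).
  { unfold vK, Rdiv; rewrite Rmult_comm, <- lsum_scal.
    apply lsum_ext; intros i _; unfold a; field; lra. }
  assert (HvK0 : 0 <= vK).
  { rewrite HvK; apply lsum_nonneg; intros i Hi; unfold a.
    enough ((s - p i) ^ j / s ^ j <= 1) by lra.
    apply Rle_div_l; [easy|]; rewrite Rmult_1_l.
    destruct (dict_le_mass p i K Hd Hi); apply pow_incr; unfold s; lra. }
  set (Y := fun w => lsum (fun i => missing i (firstn j w) - a i) (seq 1 K)).
  rewrite (trunc_E_ext _ _ _ _ (fun w => Y w ^ 2 + (- 2 * (vK - v) * Y w + (vK - v) ^ 2 * 1))).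
  2:{ intros w Hw; rewrite (Rdist_missing n K) by easy.
      rewrite HvK; unfold Y; rewrite !lsum_minus, lsum_const, length_seq; ring. }
  rewrite 2!trunc_E_plus, 2!trunc_E_scal, trunc_E_one; fold s.
  assert (HY : trunc_E p n K Y = 0).
  { unfold Y; rewrite trunc_E_lsum, <- (Rmult_0_r (INR (length (seq 1 K)))), <- lsum_const.
    apply lsum_ext; intros i Hi.
    rewrite (trunc_E_ext _ _ _ _ (fun w => missing i (firstn j w) + - a i * 1))
      by (intros; ring).
    rewrite trunc_E_plus, trunc_E_scal, trunc_E_missing, trunc_E_one by easy; fold s.
    replace n with (j + (n - j))%nat at 2 by lia; rewrite pow_add.
    unfold a; field; lra. }
  rewrite HY.
  assert (HM : 0 <= s ^ n <= 1).
  { split; [apply pow_le; lra|]. rewrite <- (pow1 n); apply pow_incr; lra. }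
  pose proof (lsum_missing_var p n K j a (proj1 Hd) Hj HK ltac:(easy)) as HV.
  fold s in HV; rewrite <- HvK in HV; fold Y in HV.
  pose proof (pow2_ge_0 (vK - v)).
  change (trunc_E p n K (fun w => Y w ^ 2) <= s ^ n * vK) in HV.
  assert (s ^ n * vK <= 1 * vK) by (apply Rmult_le_compat_r; lra).
  assert ((vK - v) ^ 2 * s ^ n <= (vK - v) ^ 2 * 1) by (apply Rmult_le_compat_l; lra).
  lra.
Qed.

(** A single [K0] must serve every [j <= n], because the bound is later integrated over [t] with [j
    = [nt]]. The slack 1 absorbs the truncation. *)
Lemma trunc_E_variance (p : nat -> R) (n : nat) :
  is_dict p -> exists K0, forall K, (K0 <= K)%nat -> forall j, (j <= n)%nat ->
  trunc_E p n K (fun w => (INR (Defs.Rdist j w) - ER p j) ^ 2) <= ER p j + 1.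
Proof.
  intros Hd.
  assert (H1 : forall j, (j <= n)%nat -> exists K0, forall K, (K0 <= K)%nat ->
    trunc_E p n K (fun w => (INR (Defs.Rdist j w) - ER p j) ^ 2) <= ER p j + 1).
  { intros j Hj.
    set (s := fun K => lsum p (seq 1 K)).
    set (vK := fun K => lsum (fun i => s K ^ j - (s K - p i) ^ j) (seq 1 K) / s K ^ j).
    assert (Hpow : is_lim_seq (fun K => s K ^ j) 1).
    { clear Hj; induction j as [|j IH]; [apply is_lim_seq_const|].
      simpl; rewrite <- (Rmult_1_l 1).
      apply is_lim_seq_mult'; [apply is_lim_seq_Reals; now apply dict_cv | easy]. }
    assert (Hlim : is_lim_seq vK (ER p j)).
    { replace (ER p j) with (ER p j / 1) by field.
      apply is_lim_seq_div'; [|easy|lra].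
      apply is_lim_seq_Reals; now apply ER_cv. }
    apply is_lim_seq_Reals in Hlim.
    (* A truncated mean within 1/2 of [ER p j] costs at most 1/2 + 1/4 in the bound. *)
    destruct (Hlim (1/2) ltac:(lra)) as [N HN]; exists (N + 1)%nat; intros K HK.
    eapply Rle_trans; [apply trunc_E_sqr_dev; auto; lia|].
    specialize (HN K ltac:(lia)); unfold Rfunctions.Rdist in HN.
    unfold vK, s in HN; apply Rabs_def2 in HN; nra. }
  assert (H2 : forall k, (k <= n)%nat -> exists K0, forall K, (K0 <= K)%nat -> forall j, (j <= k)%nat ->
    trunc_E p n K (fun w => (INR (Defs.Rdist j w) - ER p j) ^ 2) <= ER p j + 1).
  { induction k as [|k IH]; intros Hk.
    - destruct (H1 0%nat Hk) as [K0 HK0]; exists K0; intros K HK j Hj.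
      replace j with 0%nat by lia; auto.
    - destruct (IH ltac:(lia)) as [K1 HK1]; destruct (H1 (S k) Hk) as [K2 HK2].
      exists (K1 + K2)%nat; intros K HK j Hj.
      destruct (Nat.eq_dec j (S k)) as [->|]; [apply HK2 | apply HK1]; lia. }
  apply (H2 n); lia.
Qed.

Lemma ER_le_draws (p : nat -> R) (j : nat) : is_dict p -> ER p j <= INR j.
Proof. intros Hd; apply ER_le; auto; intros K; now apply hit_sum_le. Qed.

(** * The occupancy sum *)

(** Block [j] consists of the indices from [k * j + 1] to [k * j + k]. The upper sum starts at 0,
    one step before the lower one; this shift is the whole loss. *)
Lemma lsum_block_bounds (u v : nat -> R) (k M : nat) :
  (forall j r, (1 <= r <= k)%nat -> v (S j) <= u (k * j + r)%nat <= v j) ->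
  INR k * lsum v (seq 1 M) <= lsum u (seq 1 (k * M)) <= INR k * lsum v (seq 0 M).
Proof.
  intros H; induction M as [|M IH].
  - rewrite Nat.mul_0_r; simpl; lra.
  - replace (k * S M)%nat with (k * M + k)%nat by lia.
    rewrite seq_app, lsum_app, lsum_seq_S, seq_S, lsum_app; simpl lsum at 4.
    assert (INR k * v (S M) <= lsum u (seq (1 + k * M) k) <= INR k * v M).
    { pose proof (lsum_const (v (S M)) (seq (1 + k * M) k)) as E1.
      pose proof (lsum_const (v M) (seq (1 + k * M) k)) as E2.
      rewrite length_seq in E1, E2; rewrite <- E1, <- E2.
      split; apply lsum_le; intros i Hi; apply in_seq in Hi;
        specialize (H M (i - k * M)%nat ltac:(lia));
        replace (k * M + (i - k * M))%nat with i in H by lia; lra. }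
    simpl lsum in *; lra.
Qed.

(** For asymptotic hypotheses that say nothing about the first [N0] indices: the cost does not
    depend on [N]. *)
Lemma lsum_le_except (f g : nat -> R) (N0 N : nat) (b : R) :
  0 <= b ->
  (forall i, (1 <= i)%nat -> (i <= N0)%nat -> f i <= g i + b) ->
  (forall i, (N0 < i)%nat -> f i <= g i) ->
  lsum f (seq 1 N) <= lsum g (seq 1 N) + INR N0 * b.
Proof.
  intros Hb H1 H2.
  assert (H : lsum f (seq 1 N) <= lsum g (seq 1 N) + INR (Nat.min N N0) * b).
  { induction N as [|N IH]; [simpl; lra|].
    rewrite !lsum_seq_S.
    destruct (le_lt_dec (S N) N0) as [Hle|Hlt].
    - rewrite Nat.min_l in IH |- * by lia. rewrite S_INR.
      specialize (H1 (S N) ltac:(lia) Hle); lra.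
    - rewrite Nat.min_r in IH |- * by lia. specialize (H2 (S N) Hlt); lra. }
  assert (INR (Nat.min N N0) * b <= INR N0 * b).
  { apply Rmult_le_compat_r; [easy | apply le_INR; lia]. }
  lra.
Qed.

(** * Exponential and power estimates *)

Lemma exp_neg_bounds (y : R) : 0 <= y -> 1 - y <= exp (- y) <= / (1 + y).
Proof.
  intros Hy; split.
  - pose proof (exp_ineq1_le (- y)); lra.
  - rewrite exp_Ropp; apply Rinv_le_contravar; [lra|]. apply exp_ineq1_le.
Qed.

Lemma exp_neg_le_1 (y : R) : 0 <= y -> 0 < exp (- y) <= 1.
Proof.
  intros Hy; split; [apply exp_pos|].
  rewrite <- exp_0; destruct Hy as [Hy|<-]; [left; apply exp_increasing; lra|].
  rewrite Ropp_0; lra.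
Qed.

Lemma mul_exp_neg_le_1 (y : R) : 0 <= y -> y * exp (- y) <= 1.
Proof.
  intros Hy; pose proof (exp_neg_bounds y Hy) as [_ H].
  apply Rle_trans with (y * / (1 + y)); [apply Rmult_le_compat_l; lra|].
  apply Rle_div_l; lra.
Qed.

(** Turns the factor [Rmin 1 y] of a perturbation error into a Poissonized hit probability, whose
    sum over the words is controlled by T. *)
Lemma Rmin_1_le_exp (y : R) : 0 <= y -> Rmin 1 y <= 2 * (1 - exp (- y)).
Proof.
  intros Hy; pose proof (exp_neg_bounds y Hy) as [_ H].
  assert (Hi : (1 + y) * / (1 + y) = 1) by (field; lra).
  assert (0 < / (1 + y)) by (apply Rinv_0_lt_compat; lra).
  unfold Rmin; destruct (Rle_dec 1 y); nra.
Qed.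

Lemma exp_neg_diff_le (a b : R) : exp (- a) - exp (- b) <= exp (- a) * (b - a).
Proof.
  replace (- b) with (- a + - (b - a)) by ring; rewrite exp_plus.
  pose proof (exp_ineq1_le (- (b - a))); pose proof (exp_pos (- a)); nra.
Qed.

(** Since [e <= 1 / 2], both exponents are at least [y / 2], so the difference is at most
    [e * y * exp (- (y / 2))]; the exponential then compensates the factor [y] when [y] is large. *)
Lemma exp_neg_perturb (y y' e : R) :
  0 <= y -> 0 <= e <= 1 / 2 -> Rabs (y' - y) <= e * y ->
  Rabs (exp (- y') - exp (- y)) <= 2 * e * Rmin 1 y.
Proof.
  intros Hy He H.
  assert (Hmin : y * exp (- (y / 2)) <= 2 * Rmin 1 y).
  { pose proof (mul_exp_neg_le_1 (y / 2) ltac:(lra)).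
    pose proof (exp_neg_le_1 (y / 2) ltac:(lra)).
    unfold Rmin; destruct (Rle_dec 1 y); nra. }
  apply Rle_trans with (e * y * exp (- (y / 2))); [|nra].
  assert (Hexp : forall z, y / 2 <= z -> exp (- z) <= exp (- (y / 2))).
  { intros z [Hz|<-]; [left; apply exp_increasing; lra | lra]. }
  assert (Hey : 0 <= e * y) by nra.
  assert (e * y <= y / 2) by nra.
  apply Rabs_le_between in H.
  pose proof (exp_neg_diff_le y' y) as H1; pose proof (exp_neg_diff_le y y') as H2.
  pose proof (Hexp y' ltac:(lra)); pose proof (Hexp y ltac:(lra)).
  pose proof (exp_pos (- y)); pose proof (exp_pos (- y')).
  apply Rabs_le; split; nra.
Qed.

(** The usual bound with [a ^ (n - 1)], multiplied by [a] to avoid a truncated exponent. *)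
Lemma pow_diff_le (a b : R) (n : nat) :
  0 <= b <= a -> 0 <= a ^ n - b ^ n /\ a * (a ^ n - b ^ n) <= INR n * a ^ n * (a - b).
Proof.
  intros H; induction n as [|n [IH1 IH2]]; [simpl; lra|].
  rewrite S_INR; simpl.
  assert (0 <= b ^ n) by (apply pow_le; lra).
  split; [nra|].
  replace (a * (a * a ^ n - b * b ^ n)) with (a * (a * (a ^ n - b ^ n)) + a * (b ^ n * (a - b)))
    by ring.
  assert (a * (a * (a ^ n - b ^ n)) <= a * (INR n * a ^ n * (a - b)))
    by (apply Rmult_le_compat_l; lra).
  assert (a * (b ^ n * (a - b)) <= a * (a ^ n * (a - b))).
  { apply Rmult_le_compat_l; [lra|]. apply Rmult_le_compat_r; lra. }
  lra.
Qed.

Lemma exp_neg_INR_mul (n : nat) (y : R) : exp (- (INR n * y)) = exp (- y) ^ n.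
Proof.
  induction n as [|n IH]; [simpl; rewrite Rmult_0_l, Ropp_0; apply exp_0|].
  rewrite S_INR; simpl; rewrite <- IH, <- exp_plus; f_equal; ring.
Qed.

(** One draw contributes [exp (- q) - (1 - q) <= q ^ 2], and [n * q * exp (- n q) <= 1] turns the
    [n] contributions into [q / a] with [a = exp (- q) >= 1 / 3]. The bound is linear in [q] and
    free of [n], so it sums to at most 3. *)
Lemma poissonization (q : R) (n : nat) :
  0 <= q <= 1 -> Rabs (exp (- (INR n * q)) - (1 - q) ^ n) <= 3 * q.
Proof.
  intros Hq; rewrite exp_neg_INR_mul.
  pose proof (exp_neg_bounds q ltac:(lra)) as [H1 H2].
  pose proof (exp_neg_le_1 q ltac:(lra)).
  assert (Hi : (1 + q) * / (1 + q) = 1) by (field; lra).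
  assert (0 < / (1 + q)) by (apply Rinv_0_lt_compat; lra).
  set (a := exp (- q)) in *.
  destruct (pow_diff_le a (1 - q) n) as [H3 H4]; [lra|].
  rewrite Rabs_right by lra.
  assert (Ha3 : 1 / 3 <= a).
  { assert (exp (- (1)) <= a).
    { unfold a; destruct (Req_dec q 1) as [->|]; [lra|].
      left; apply exp_increasing; lra. }
    pose proof exp_le_3; pose proof (exp_pos 1).
    rewrite exp_Ropp in H5; replace (1 / 3) with (/ 3) by field.
    apply Rle_trans with (/ exp 1); [apply Rinv_le_contravar; lra | easy]. }
  assert (Hab : a - (1 - q) <= q ^ 2).
  { assert (/ (1 + q) <= 1 - q + q ^ 2); [|lra].
    apply Rmult_le_reg_l with (1 + q); [lra|]. rewrite Hi.
    assert (0 <= q ^ 3) by (apply pow_le; lra). lra. }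
  assert (HY : INR n * q * a ^ n <= 1).
  { unfold a; rewrite <- exp_neg_INR_mul; apply mul_exp_neg_le_1.
    apply Rmult_le_pos; [apply pos_INR | lra]. }
  assert (0 <= INR n * a ^ n) by (apply Rmult_le_pos; [apply pos_INR | apply pow_le; lra]).
  assert (INR n * a ^ n * (a - (1 - q)) <= INR n * a ^ n * q ^ 2)
    by (apply Rmult_le_compat_l; lra).
  assert (INR n * a ^ n * q ^ 2 <= q) by nra.
  nra.
Qed.

Lemma inv_sqrt_sum (x : R) (N : nat) :
  0 <= x ->
  lsum (fun i => if Rle_dec (INR i) x then / sqrt (INR i) else 0) (seq 1 N) <= 2 * sqrt x.
Proof.
  intros Hx.
  set (f := fun i => _).
  (* The bound by [sqrt (INR N)] drives the telescoping; it gives the bound by [sqrt x] whenever a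
     nonzero term is added. *)
  enough (lsum f (seq 1 N) <= 2 * sqrt x /\ lsum f (seq 1 N) <= 2 * sqrt (INR N)) by tauto.
  induction N as [|N [IH1 IH2]].
  - simpl; pose proof (sqrt_pos x); pose proof (sqrt_pos 0); lra.
  - rewrite lsum_seq_S; unfold f at 2 4.
    assert (sqrt (INR N) <= sqrt (INR (S N))) by (apply sqrt_le_1_alt, le_INR; lia).
    destruct (Rle_dec (INR (S N)) x) as [Hle|Hgt]; [|lra].
    pose proof (sqrt_le_1_alt _ _ Hle).
    assert (HS : 0 < INR (S N)) by (apply lt_0_INR; lia).
    pose proof (sqrt_lt_R0 _ HS).
    pose proof (sqrt_sqrt _ (pos_INR N)); pose proof (sqrt_sqrt (INR (S N)) ltac:(lra)).
    pose proof (sqrt_pos (INR N)).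
    assert (/ sqrt (INR (S N)) <= 2 * (sqrt (INR (S N)) - sqrt (INR N))).
    { apply Rmult_le_reg_l with (sqrt (INR (S N))); [easy|].
      rewrite Rinv_r by lra. rewrite S_INR in *. nra. }
    lra.
Qed.

(** * The occupancy function and its sums *)

Definition occ (alpha u : R) : R := 1 - exp (- Rpower u alpha).

Lemma Rpower_pos (x y : R) : 0 < Rpower x y.
Proof. apply exp_pos. Qed.

Lemma occ_bounds (alpha u : R) : 0 < occ alpha u < 1.
Proof.
  unfold occ; pose proof (exp_pos (- Rpower u alpha)); split; [|lra].
  enough (exp (- Rpower u alpha) < 1) by lra.
  rewrite <- exp_0; apply exp_increasing; pose proof (Rpower_pos u alpha); lra.
Qed.

Lemma occ_le (alpha u v : R) : 0 < alpha -> 0 < u <= v -> occ alpha u <= occ alpha v.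
Proof.
  intros Ha Huv; unfold occ.
  enough (exp (- Rpower v alpha) <= exp (- Rpower u alpha)) by lra.
  assert (Rpower u alpha <= Rpower v alpha) by (apply Rle_Rpower_l; lra).
  destruct (Req_dec (Rpower u alpha) (Rpower v alpha)) as [->|]; [lra|].
  left; apply exp_increasing; lra.
Qed.

Definition occ_sum (alpha x : R) (N : nat) : R :=
  lsum (fun i => occ alpha (x / INR i)) (seq 1 N).

(** The total is characterized as a least upper bound, so that both directions of every later
    comparison reduce to partial sums. *)
Definition is_occ_total (alpha : R) (T : R -> R) : Prop :=
  forall x, 0 < x -> (forall N, occ_sum alpha x N <= T x) /\
    (forall B, (forall N, occ_sum alpha x N <= B) -> T x <= B).

Lemma INR_ge_1 (k : nat) : (1 <= k)%nat -> 1 <= INR k.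
Proof. intros H; apply (le_INR 1 k H). Qed.

(** [occ] sees only the ratio, and [k x / (k l) = x / l]: the terms of block [j] at [k x] lie
    between the terms [j + 1] and [j] at [x]. *)
Lemma occ_sum_scale (alpha x : R) (k M : nat) :
  0 < alpha -> 0 < x -> (1 <= k)%nat ->
  INR k * occ_sum alpha x M <= occ_sum alpha (INR k * x) (k * M)
    <= INR k * (occ_sum alpha x M + 1).
Proof.
  intros Ha Hx Hk; pose proof (INR_ge_1 k Hk).
  (* The first block has no left neighbour and is bounded by the supremum 1 of [occ]; this is the
     source of the [+ 1]. *)
  set (v := fun j => match j with 0%nat => 1 | S _ => occ alpha (x / INR j) end).
  assert (Hv : lsum v (seq 1 M) = occ_sum alpha x M).
  { apply lsum_ext; intros [|i] Hi; [apply in_seq in Hi; lia | easy]. }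
  destruct (lsum_block_bounds (fun i => occ alpha (INR k * x / INR i)) v k M) as [H1 H2].
  - intros j r Hr.
    assert (Hi : 0 < INR (k * j + r)) by (apply lt_0_INR; lia).
    assert (Hcmp : forall l, (1 <= l)%nat -> INR k * x / (INR k * INR l) = x / INR l).
    { intros l Hl; pose proof (INR_ge_1 l Hl); field; lra. }
    assert (Hkx : 0 < INR k * x) by nra.
    assert (Hpos : forall l, (1 <= l)%nat -> 0 < x / INR l).
    { intros l Hl; pose proof (INR_ge_1 l Hl); apply Rdiv_lt_0_compat; lra. }
    split.
    + unfold v; apply occ_le; [easy|]; split; [apply Hpos; lia|].
      rewrite <- Hcmp by lia; apply Rmult_le_compat_l; [lra|].
      apply Rinv_le_contravar; [easy|]. rewrite <- mult_INR; apply le_INR; nia.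
    + destruct j as [|j]; [left; apply occ_bounds|].
      unfold v; apply occ_le; [easy|]; split; [now apply Rdiv_lt_0_compat|].
      rewrite <- Hcmp by lia; apply Rmult_le_compat_l; [lra|].
      rewrite <- mult_INR; apply Rinv_le_contravar; [apply lt_0_INR; nia|].
      apply le_INR; nia.
  - rewrite Hv in H1; split; [exact H1|].
    eapply Rle_trans; [exact H2|]; apply Rmult_le_compat_l; [lra|].
    rewrite <- Hv.
    apply Rle_trans with (lsum v (seq 0 (S M))).
    + rewrite seq_S, lsum_app; simpl lsum at 3.
      assert (0 < v M) by (destruct M; simpl; [lra | apply occ_bounds]). simpl; lra.
    + simpl; lra.
Qed.

Lemma occ_sum_growing (alpha x : R) (N N' : nat) :
  (N <= N')%nat -> occ_sum alpha x N <= occ_sum alpha x N'.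
Proof.
  intros H; induction H as [|N' H IH]; [lra|].
  unfold occ_sum in *; rewrite lsum_seq_S.
  pose proof (occ_bounds alpha (x / INR (S N'))); lra.
Qed.

Lemma occ_total_scale (alpha : R) (T : R -> R) (x : R) (k : nat) :
  0 < alpha -> is_occ_total alpha T -> 0 < x -> (1 <= k)%nat ->
  INR k * T x <= T (INR k * x) <= INR k * (T x + 1).
Proof.
  intros Ha HT Hx Hk; pose proof (INR_ge_1 k Hk).
  destruct (HT x Hx) as [U1 L1]; destruct (HT (INR k * x) ltac:(nra)) as [U2 L2].
  split.
  - rewrite Rmult_comm; apply Rle_div_r; [lra|]; apply L1; intros N.
    apply Rle_div_r; [lra|]; rewrite Rmult_comm.
    eapply Rle_trans; [apply occ_sum_scale; auto | apply U2].
  - apply L2; intros N.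
    apply Rle_trans with (occ_sum alpha (INR k * x) (k * N)); [apply occ_sum_growing; nia|].
    eapply Rle_trans; [apply occ_sum_scale; auto|].
    apply Rmult_le_compat_l; [lra|]. specialize (U1 N); lra.
Qed.

Lemma occ_total_le (alpha : R) (T : R -> R) (x y : R) :
  0 < alpha -> is_occ_total alpha T -> 0 < x <= y -> T x <= T y.
Proof.
  intros Ha HT Hxy; apply (HT x); [lra|]; intros N.
  apply Rle_trans with (occ_sum alpha y N); [|apply HT; lra].
  apply lsum_le; intros i Hi; apply in_seq in Hi; pose proof (INR_ge_1 i ltac:(lia)).
  apply occ_le; [easy|]; split; [apply Rdiv_lt_0_compat; lra|].
  apply Rmult_le_compat_r; [left; apply Rinv_0_lt_compat; lra | lra].
Qed.

(* Comparing T (k l) with both k T(l) and l T(k) gives T(l)/l <= (T(k) + 1)/k, so that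
   C := sup T(l)/l satisfies C k - 1 <= T(k) <= C k; no improper integral is needed. *)
Lemma occ_total_linear (alpha : R) (T : R -> R) :
  0 < alpha -> is_occ_total alpha T ->
  exists C, 0 < C /\ forall x, 1 <= x -> Rabs (T x - C * x) <= C + 1.
Proof.
  intros Ha HT.
  assert (Hkl : forall k l, (1 <= k)%nat -> (1 <= l)%nat ->
    T (INR l) / INR l <= (T (INR k) + 1) / INR k).
  { intros k l Hk Hl; pose proof (INR_ge_1 k Hk); pose proof (INR_ge_1 l Hl).
    destruct (occ_total_scale alpha T (INR l) k Ha HT ltac:(lra) Hk) as [H1 _].
    destruct (occ_total_scale alpha T (INR k) l Ha HT ltac:(lra) Hl) as [_ H2].
    rewrite (Rmult_comm (INR l) (INR k)) in H2 at 1.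
    apply Rle_div_l; [lra|]; unfold Rdiv; rewrite Rmult_assoc, (Rmult_comm (/ _)), <- Rmult_assoc.
    apply Rle_div_r; lra. }
  destruct (completeness (fun y => exists l, (1 <= l)%nat /\ y = T (INR l) / INR l)) as [C [HC1 HC2]].
  { exists ((T (INR 1) + 1) / INR 1); intros y [l [Hl ->]]; apply Hkl; lia. }
  { exists (T (INR 1) / INR 1), 1%nat; split; [lia | easy]. }
  assert (HC : forall k, (1 <= k)%nat -> C * INR k - 1 <= T (INR k) <= C * INR k).
  { intros k Hk; pose proof (INR_ge_1 k Hk); split.
    - assert (C <= (T (INR k) + 1) / INR k).
      { apply HC2; intros y [l [Hl ->]]; now apply Hkl. }
      apply Rle_div_r in H0; lra.
    - apply Rle_div_l; [lra|]; apply HC1; now exists k. }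
  assert (HC0 : 0 < C).
  { destruct (HC 1%nat ltac:(lia)) as [_ H]; simpl in H.
    pose proof (proj1 (HT 1 ltac:(lra)) 1%nat) as H1; unfold occ_sum in H1; simpl in H1.
    pose proof (occ_bounds alpha (1 / 1)); lra. }
  exists C; split; [exact HC0|].
  intros x Hx.
  (* Monotonicity of [T] carries the integer bounds to real [x], at the price of one more [C]. *)
  destruct (nfloor_ex x ltac:(lra)) as [k [Hk1 Hk2]].
  assert (Hk : (1 <= k)%nat).
  { destruct k; [simpl in Hk2; lra | lia]. }
  pose proof (INR_ge_1 k Hk).
  pose proof (occ_total_le alpha T (INR k) x Ha HT ltac:(lra)).
  pose proof (occ_total_le alpha T x (INR (S k)) Ha HT ltac:(rewrite S_INR; lra)).
  pose proof (HC k Hk); pose proof (HC (S k) ltac:(lia)); rewrite S_INR in *.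
  apply Rabs_le; split; nra.
Qed.

(** * Asymptotics of the mean *)

(** The partial sums are bounded through [1 - exp (- y) <= y]. *)
Lemma occ_total_exists (alpha B : R) :
  (forall N, lsum (fun i => Rpower (/ INR i) alpha) (seq 1 N) <= B) ->
  exists T, is_occ_total alpha T.
Proof.
  intros HB; exists (fun x => seq_lim (occ_sum alpha x)); intros x Hx.
  assert (Hg : Un_growing (occ_sum alpha x)) by (intros N; apply occ_sum_growing; lia).
  destruct (growing_cv (occ_sum alpha x) Hg) as [T HT].
  { exists (Rpower x alpha * B); intros y [N ->].
    apply Rle_trans with (lsum (fun i => Rpower x alpha * Rpower (/ INR i) alpha) (seq 1 N)).
    - apply lsum_le; intros i Hi; apply in_seq in Hi; pose proof (INR_ge_1 i ltac:(lia)).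
      rewrite Rpower_mult_distr; [|lra|apply Rinv_0_lt_compat; lra].
      unfold occ, Rdiv; pose proof (exp_ineq1_le (- Rpower (x * / INR i) alpha)); lra.
    - rewrite lsum_scal; apply Rmult_le_compat_l; [left; apply Rpower_pos | easy]. }
  rewrite (seq_lim_unique _ _ HT); split.
  - now apply growing_ineq.
  - intros b Hb; apply (is_lim_seq_le (occ_sum alpha x) (fun _ => b) T b Hb).
    + now apply is_lim_seq_Reals.
    + apply is_lim_seq_const.
Qed.

Definition zipf (theta c : R) (i : nat) : R := c * Rpower (INR i) (- / theta).

Definition near_zipf (theta c : R) (p : nat -> R) : Prop :=
  Un_cv (fun i => (p (S i) / zipf theta c (S i) - 1) * sqrt (INR (S i))) 0.

Lemma near_zipf_error (theta c : R) (p : nat -> R) (e : R) :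
  0 < c -> near_zipf theta c p -> 0 < e ->
  exists N0, forall i, (N0 < i)%nat ->
    Rabs (p i - zipf theta c i) <= e / sqrt (INR i) * zipf theta c i.
Proof.
  intros Hc Hz He; destruct (Hz e He) as [N0 HN]; exists N0; intros [|i] Hi; [lia|].
  specialize (HN i ltac:(lia)).
  assert (Hq : 0 < zipf theta c (S i)) by (apply Rmult_lt_0_compat; [easy | apply Rpower_pos]).
  assert (Hs : 0 < sqrt (INR (S i))) by (apply sqrt_lt_R0, lt_0_INR; lia).
  set (s := sqrt (INR (S i))) in *; set (q := zipf theta c (S i)) in *.
  unfold Rfunctions.Rdist in HN; rewrite Rminus_0_r, Rabs_mult, (Rabs_right s) in HN by lra.
  replace (p (S i) - q) with ((p (S i) / q - 1) * q) by (field; lra).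
  rewrite Rabs_mult, (Rabs_right q) by lra.
  apply Rmult_le_compat_r; [lra|]. apply Rle_div_r; [easy | lra].
Qed.

Lemma Rpower_le_1 (x y : R) : 1 <= x -> y <= 0 -> Rpower x y <= 1.
Proof.
  intros Hx Hy; rewrite <- (Rpower_O x) by lra; now apply Rle_Rpower.
Qed.

Lemma inv_sqrt_le_1 (i : nat) : (1 <= i)%nat -> 0 < / sqrt (INR i) <= 1.
Proof.
  intros Hi; pose proof (INR_ge_1 i Hi).
  assert (1 <= sqrt (INR i)) by (rewrite <- sqrt_1; apply sqrt_le_1_alt; lra).
  split; [apply Rinv_0_lt_compat; lra|].
  rewrite <- Rinv_1; apply Rinv_le_contravar; lra.
Qed.

(** Summability of the power law is read off from that of [p]: beyond [N0] the power law is at most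
    [2 * p i], and each earlier term is at most [c]. *)
Lemma zipf_total_exists (theta c : R) (p : nat -> R) :
  0 < theta -> 0 < c -> is_dict p -> near_zipf theta c p ->
  exists T, is_occ_total (/ theta) T.
Proof.
  intros Ht Hc Hd Hz.
  destruct (near_zipf_error theta c p (1 / 2) Hc Hz ltac:(lra)) as [N0 HN].
  apply occ_total_exists with ((2 + INR N0 * c) / c); intros N.
  apply Rle_div_r; [easy|]; rewrite Rmult_comm, <- lsum_scal.
  rewrite (lsum_ext _ (zipf theta c)).
  2:{ intros i Hi; apply in_seq in Hi; pose proof (INR_ge_1 i ltac:(lia)).
      unfold zipf, Rpower; rewrite ln_Rinv by lra; do 2 f_equal; ring. }
  assert (Hit : 0 < / theta) by now apply Rinv_0_lt_compat.
  eapply Rle_trans; [apply (lsum_le_except _ (fun i => 2 * p i) N0 N c)|].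
  - lra.
  - intros i Hi _; pose proof (INR_ge_1 i Hi).
    pose proof (Rpower_le_1 (INR i) (- / theta) ltac:(lra) ltac:(lra)).
    pose proof (proj1 Hd i Hi); unfold zipf; nra.
  - intros i Hi; specialize (HN i Hi).
    destruct (inv_sqrt_le_1 i ltac:(lia)).
    assert (0 < zipf theta c i) by (apply Rmult_lt_0_compat; [easy | apply Rpower_pos]).
    apply Rabs_le_between in HN; unfold Rdiv in HN; nra.
  - rewrite lsum_scal; pose proof (dict_mass p N Hd); lra.
Qed.

(** Explains the choice [x = (c n)^theta]: [occ (/ theta) (x / i)] is then the Poissonized hit
    probability of word [i], and [i = x] is where the expected count passes 1. *)
Lemma zipf_scale (theta c : R) (n i : nat) :
  0 < theta -> 0 < c -> (1 <= n)%nat -> (1 <= i)%nat ->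
  Rpower (Rpower (c * INR n) theta / INR i) (/ theta) = INR n * zipf theta c i.
Proof.
  intros Ht Hc Hn Hi; pose proof (INR_ge_1 n Hn); pose proof (INR_ge_1 i Hi).
  unfold Rdiv; rewrite <- Rpower_mult_distr; [|apply Rpower_pos|apply Rinv_0_lt_compat; lra].
  rewrite Rpower_mult, Rinv_r, Rpower_1 by nra.
  unfold zipf, Rpower; rewrite ln_Rinv by lra.
  replace (/ theta * - ln (INR i)) with (- / theta * ln (INR i)) by ring; ring.
Qed.

Lemma ER_occ_total (theta c e : R) (p : nat -> R) (T : R -> R) (n N0 : nat) :
  0 < theta -> 0 < c -> is_dict p -> is_occ_total (/ theta) T -> 0 <= e <= 1 / 2 ->
  (forall i, (N0 < i)%nat ->
    Rabs (p i - zipf theta c i) <= e / sqrt (INR i) * zipf theta c i) ->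
  (1 <= n)%nat ->
  let x := Rpower (c * INR n) theta in
  Rabs (ER p n - T x) <= INR N0 + 3 + 2 * e * (2 * sqrt x + 2 / sqrt x * T x).
Proof.
  intros Ht Hc Hd HT He HN Hn x.
  assert (Hx : 0 < x) by apply Rpower_pos.
  pose proof (sqrt_lt_R0 x Hx) as Hsx.
  set (q := zipf theta c) in *.
  (* The first term is the cost of Poissonization. The rest bounds the perturbation with relative
     error [e / sqrt i]: for [i <= x] its factor [Rmin] is at most 1, and for [i > x] one uses
     [/ sqrt i <= / sqrt x] and [Rmin 1 y <= 2 * (1 - exp (- y))]. *)
  set (G := fun i => 3 * p i + 2 * e * ((if Rle_dec (INR i) x then / sqrt (INR i) else 0)
                       + 2 / sqrt x * occ (/ theta) (x / INR i))).
  (* On the first [N0] indices the two exponentials differ by at most 1. *)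
  set (b := fun i => if le_lt_dec i N0 then 1 else 0).
  assert (Hterm : forall i, (1 <= i)%nat ->
    Rabs ((1 - (1 - p i) ^ n) - occ (/ theta) (x / INR i)) <= G i + b i).
  { intros i Hi.
    pose proof (dict_le_1 p i Hd Hi) as Hp.
    pose proof (poissonization (p i) n ltac:(lra)) as Hpo.
    pose proof (occ_bounds (/ theta) (x / INR i)) as Hocc.
    destruct (inv_sqrt_le_1 i Hi) as [Hi0 Hi1].
    assert (Hif : 0 <= (if Rle_dec (INR i) x then / sqrt (INR i) else 0)
                       + 2 / sqrt x * occ (/ theta) (x / INR i)).
    { assert (0 < 2 / sqrt x) by (apply Rdiv_lt_0_compat; lra).
      destruct (Rle_dec (INR i) x); nra. }
    unfold occ in Hocc, Hif |- *; unfold x in Hocc, Hif |- *.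
    unfold G, occ; fold x.
    assert (Hy : Rpower (x / INR i) (/ theta) = INR n * q i) by (apply zipf_scale; easy).
    fold x in Hocc, Hif |- *.
    rewrite Hy in *.
    replace (1 - (1 - p i) ^ n - (1 - exp (- (INR n * q i)))) with
      ((exp (- (INR n * p i)) - (1 - p i) ^ n) + - (exp (- (INR n * p i)) - exp (- (INR n * q i))))
      by ring.
    eapply Rle_trans; [apply Rabs_triang|]; rewrite Rabs_Ropp.
    enough (Rabs (exp (- (INR n * p i)) - exp (- (INR n * q i))) <=
      2 * e * ((if Rle_dec (INR i) x then / sqrt (INR i) else 0)
                       + 2 / sqrt x * (1 - exp (- (INR n * q i)))) + b i) by lra.
    pose proof (pos_INR n) as Hn0.
    assert (Hq : 0 < q i) by (apply Rmult_lt_0_compat; [easy | apply Rpower_pos]).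
    unfold b; destruct (le_lt_dec i N0) as [Hle|Hgt].
    - pose proof (exp_neg_le_1 (INR n * p i) ltac:(nra)).
      pose proof (exp_neg_le_1 (INR n * q i) ltac:(nra)).
      assert (Rabs (exp (- (INR n * p i)) - exp (- (INR n * q i))) <= 1)
        by (apply Rabs_le; lra).
      nra.
    - specialize (HN i Hgt).
      eapply Rle_trans; [apply (exp_neg_perturb _ _ (e / sqrt (INR i)))|].
      + nra.
      + unfold Rdiv; nra.
      + rewrite <- Rmult_minus_distr_l, Rabs_mult, (Rabs_right (INR n)) by lra.
        rewrite <- Rmult_assoc, (Rmult_comm (_ / _)), Rmult_assoc.
        now apply Rmult_le_compat_l.
      + pose proof (Rmin_1_le_exp (INR n * q i) ltac:(nra)) as Hm.
        pose proof (Rmin_l 1 (INR n * q i)) as Hm1.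
        set (z := 1 - exp (- (INR n * q i))) in *.
        set (mi := Rmin 1 (INR n * q i)) in *.
        enough (/ sqrt (INR i) * mi <= (if Rle_dec (INR i) x then / sqrt (INR i) else 0)
                       + 2 / sqrt x * z).
        { rewrite Rplus_0_r; unfold Rdiv at 1.
          replace (2 * (e * / sqrt (INR i)) * mi) with (2 * e * (/ sqrt (INR i) * mi)) by ring.
          apply Rmult_le_compat_l; lra. }
        assert (0 < / sqrt x) by now apply Rinv_0_lt_compat.
        unfold Rdiv; destruct (Rle_dec (INR i) x).
        * assert (0 <= 2 * / sqrt x * z) by nra. nra.
        * assert (/ sqrt (INR i) <= / sqrt x).
          { apply Rinv_le_contravar; [easy|]; apply sqrt_le_1_alt; lra. }
          rewrite Rplus_0_l.
          apply Rle_trans with (/ sqrt (INR i) * (2 * z)); [apply Rmult_le_compat_l; lra|].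
          replace (2 * / sqrt x * z) with (/ sqrt x * (2 * z)) by ring.
          apply Rmult_le_compat_r; lra. }
  assert (HGN : forall N, lsum G (seq 1 N) <= 3 + 2 * e * (2 * sqrt x + 2 / sqrt x * T x)).
  { intros N; unfold G; rewrite lsum_plus, !lsum_scal, lsum_plus, lsum_scal.
    pose proof (dict_mass p N Hd).
    pose proof (inv_sqrt_sum x N ltac:(lra)).
    pose proof (proj1 (HT x Hx) N) as HTN; unfold occ_sum in HTN.
    assert (2 / sqrt x * lsum (fun i => occ (/ theta) (x / INR i)) (seq 1 N) <= 2 / sqrt x * T x).
    { apply Rmult_le_compat_l; [left; apply Rdiv_lt_0_compat; lra | easy]. }
    apply Rplus_le_compat; [lra|]. apply Rmult_le_compat_l; lra. }
  assert (Hsplit : forall i, (1 <= i)%nat ->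
    ((i <= N0)%nat -> b i = 1) /\ ((N0 < i)%nat -> b i = 0)).
  { intros i _; unfold b; destruct (le_lt_dec i N0); split; intros; try easy; lia. }
  assert (H1 : ER p n <= T x + (3 + 2 * e * (2 * sqrt x + 2 / sqrt x * T x)) + INR N0).
  { apply ER_le; [easy|]; intros N.
    eapply Rle_trans; [apply (lsum_le_except _ (fun i => occ (/ theta) (x / INR i) + G i) N0 N 1)|].
    - lra.
    - intros i Hi Hle; specialize (Hterm i Hi); apply Rabs_le_between in Hterm.
      destruct (Hsplit i Hi) as [Hb _]; rewrite Hb in Hterm; auto; lra.
    - intros i Hlt; specialize (Hterm i ltac:(lia)); apply Rabs_le_between in Hterm.
      destruct (Hsplit i ltac:(lia)) as [_ Hb]; rewrite Hb in Hterm; auto; lra.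
    - rewrite lsum_plus; pose proof (proj1 (HT x Hx) N) as HTN; unfold occ_sum in HTN.
      specialize (HGN N); lra. }
  assert (H2 : T x <= ER p n + (3 + 2 * e * (2 * sqrt x + 2 / sqrt x * T x)) + INR N0).
  { apply (HT x Hx); intros N; unfold occ_sum.
    eapply Rle_trans; [apply (lsum_le_except _ (fun i => (1 - (1 - p i) ^ n) + G i) N0 N 1)|].
    - lra.
    - intros i Hi Hle; specialize (Hterm i Hi); apply Rabs_le_between in Hterm.
      destruct (Hsplit i Hi) as [Hb _]; rewrite Hb in Hterm; auto; lra.
    - intros i Hlt; specialize (Hterm i ltac:(lia)); apply Rabs_le_between in Hterm.
      destruct (Hsplit i ltac:(lia)) as [_ Hb]; rewrite Hb in Hterm; auto; lra.
    - rewrite lsum_plus; pose proof (ER_ge p n N Hd); specialize (HGN N); lra. }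
  apply Rabs_le; lra.
Qed.

Lemma Rpower_scale_unbounded (theta c B : R) :
  0 < theta -> 0 < c ->
  exists N, (1 <= N)%nat /\ forall n, (N <= n)%nat -> B <= Rpower (c * INR n) theta.
Proof.
  intros Ht Hc.
  set (b := Rmax B 1).
  destruct (nfloor_ex (Rpower b (/ theta) / c)) as [N [_ HN]].
  { left; apply Rdiv_lt_0_compat; [apply Rpower_pos | easy]. }
  exists (S N); split; [lia|]; intros n Hn.
  apply Rle_trans with b; [apply Rmax_l|].
  assert (Hb : 0 < b) by (pose proof (Rmax_r B 1); unfold b; lra).
  rewrite <- (Rpower_1 b Hb), <- (Rinv_l theta) at 1 by lra.
  rewrite <- Rpower_mult; apply Rle_Rpower_l; [lra|]; split; [apply Rpower_pos|].
  apply le_INR in Hn; rewrite S_INR in Hn; apply Rlt_div_l in HN; [nra | easy].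
Qed.

Lemma ER_asymptotics (theta c : R) (p : nat -> R) :
  0 < theta -> 0 < c -> is_dict p -> near_zipf theta c p ->
  exists C, 0 < C /\ forall eps, 0 < eps -> exists N, (1 <= N)%nat /\ forall n, (N <= n)%nat ->
    Rabs (ER p n - C * Rpower (c * INR n) theta) <= eps * sqrt (Rpower (c * INR n) theta).
Proof.
  intros Ht Hc Hd Hz.
  destruct (zipf_total_exists theta c p Ht Hc Hd Hz) as [T HT].
  destruct (occ_total_linear (/ theta) T (Rinv_0_lt_compat _ Ht) HT) as [C [HC0 HC]].
  exists C; split; [easy|]; intros eps Heps.
  (* The perturbation term is at most [2 * e * (6 + 4 * C) * sqrt x], which is half of
     [e * Q * sqrt x]; the other half of [eps] absorbs the bounded part [K0]. *)
  set (Q := 4 * (6 + 4 * C)).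
  assert (HQ : 0 < Q) by (unfold Q; lra).
  set (e := Rmin (1 / 2) (eps / Q)).
  assert (He0 : 0 < e) by (apply Rmin_pos; [lra | now apply Rdiv_lt_0_compat]).
  assert (He1 : e <= 1 / 2) by apply Rmin_l.
  assert (He2 : e * Q <= eps) by (apply Rle_div_r; [easy | apply Rmin_r]).
  destruct (near_zipf_error theta c p e Hc Hz He0) as [N0 HN0].
  set (K0 := INR N0 + 3 + (C + 1)).
  destruct (Rpower_scale_unbounded theta c (1 + (2 * K0 / eps) ^ 2) Ht Hc) as [N [HN1 HN]].
  exists N; split; [easy|]; intros n Hn.
  pose proof (ER_occ_total theta c e p T n N0 Ht Hc Hd HT ltac:(lra) HN0 ltac:(lia)) as H1.
  specialize (HN n Hn).
  set (x := Rpower (c * INR n) theta) in *; cbv zeta in H1.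
  assert (HK0 : 0 <= 2 * K0 / eps).
  { apply Rle_div_r; [easy|]; unfold K0; pose proof (pos_INR N0); lra. }
  pose proof (pow2_ge_0 (2 * K0 / eps)).
  specialize (HC x ltac:(lra)).
  assert (HK : K0 <= eps / 2 * sqrt x).
  { assert (2 * K0 / eps <= sqrt x).
    { rewrite <- (sqrt_pow2 (2 * K0 / eps)) by easy. apply sqrt_le_1_alt; lra. }
    apply Rle_div_l in H0; [lra | easy]. }
  assert (Hs1 : 1 <= sqrt x) by (rewrite <- sqrt_1; apply sqrt_le_1_alt; lra).
  pose proof (sqrt_sqrt x ltac:(lra)) as Hss.
  assert (HT2 : 2 / sqrt x * T x <= 4 * (C + 1) * sqrt x).
  { apply Rabs_le_between in HC.
    assert (T x <= 2 * (C + 1) * (sqrt x * sqrt x)) by (rewrite Hss; nra).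
    apply Rle_trans with (2 / sqrt x * (2 * (C + 1) * (sqrt x * sqrt x))).
    - apply Rmult_le_compat_l; [|easy]. left; apply Rdiv_lt_0_compat; lra.
    - right; field; lra. }
  replace (ER p n - C * x) with ((ER p n - T x) + (T x - C * x)) by ring.
  eapply Rle_trans; [apply Rabs_triang|].
  assert (2 * e * (2 * sqrt x + 2 / sqrt x * T x) <= 2 * e * ((6 + 4 * C) * sqrt x)).
  { apply Rmult_le_compat_l; lra. }
  assert (e * Q * sqrt x <= eps * sqrt x) by (apply Rmult_le_compat_r; lra).
  unfold K0, Q in *; lra.
Qed.

(** * Linearization of the logarithm *)

Lemma ln_bounds (u : R) : 0 < u -> 1 - / u <= ln u <= u - 1.
Proof.
  intros Hu.
  assert (H : forall w, 0 < w -> ln w <= w - 1).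
  { intros w Hw; pose proof (exp_ineq1_le (ln w)); rewrite exp_ln in H; lra. }
  split; [|now apply H].
  pose proof (H (/ u) (Rinv_0_lt_compat _ Hu)); rewrite ln_Rinv in H0; lra.
Qed.

Lemma ln_near_1 (h : R) : Rabs h <= 1 / 2 -> Rabs (ln (1 + h)) <= 2 * Rabs h.
Proof.
  intros Hh; pose proof (Rabs_pos h); apply Rabs_le_between in Hh.
  destruct (ln_bounds (1 + h) ltac:(lra)) as [H1 H2].
  assert (1 - / (1 + h) = h / (1 + h)) by (field; lra).
  assert (Hi : (1 + h) * / (1 + h) = 1) by (field; lra).
  assert (0 < / (1 + h)) by (apply Rinv_0_lt_compat; lra).
  unfold Rabs in *; destruct (Rcase_abs h), (Rcase_abs (ln (1 + h))); nra.
Qed.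

(* For [r/v < 1/2] the Taylor bound for [ln] fails; there [r >= 1] still bounds
   [ln (r/v)] below by [- ln v], whence the factor [1 + ln v]. *)
Lemma ln_second_order (r v : R) :
  1 <= r -> 1 <= v ->
  Rabs (ln r - ln v - (r / v - 1)) <= 4 * (1 + ln v) * (r / v - 1) ^ 2.
Proof.
  intros Hr Hv.
  assert (Hlv : 0 <= ln v) by (rewrite <- ln_1; apply ln_le; lra).
  assert (Hlr : 0 <= ln r) by (rewrite <- ln_1; apply ln_le; lra).
  assert (Hu : 0 < r / v) by (apply Rdiv_lt_0_compat; lra).
  assert (Hl : ln (r / v) = ln r - ln v) by (apply ln_div; lra).
  destruct (ln_bounds (r / v) Hu) as [H1 H2]; rewrite Hl in H1, H2.
  set (u := r / v) in *.
  assert (Hi : u * / u = 1) by (field; lra).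
  pose proof (pow2_ge_0 (u - 1)) as Hsq.
  assert (0 <= ln v * (u - 1) ^ 2) by nra.
  destruct (Rle_dec (1 / 2) u).
  - assert (/ u <= 2).
    { replace 2 with (/ (1 / 2)) by field; apply Rinv_le_contravar; lra. }
    assert (1 - / u - (u - 1) = - (/ u * (u - 1) ^ 2)) by (field; lra).
    assert (/ u * (u - 1) ^ 2 <= 2 * (u - 1) ^ 2) by (apply Rmult_le_compat_r; lra).
    apply Rabs_le; lra.
  - assert (1 / 4 <= (u - 1) ^ 2) by nra.
    assert ((1 + ln v) * (1 / 4) <= (1 + ln v) * (u - 1) ^ 2) by (apply Rmult_le_compat_l; lra).
    apply Rabs_le; lra.
Qed.

(** [C] is chosen before [eps] and [B], so the same [ln C] occurs at [n] and at [[nt]] and cancels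
    in the difference. *)
Lemma ER_log_asymptotics (theta c : R) (p : nat -> R) :
  0 < theta -> 0 < c -> is_dict p -> near_zipf theta c p ->
  exists C, 0 < C /\ forall eps B, 0 < eps -> exists N, (1 <= N)%nat /\ forall n, (N <= n)%nat ->
    let x := Rpower (c * INR n) theta in
    B <= ER p n <= 2 * C * x /\
    Rabs (ln (ER p n) - ln C - ln x) <= eps / sqrt x.
Proof.
  intros Ht Hc Hd Hz.
  destruct (ER_asymptotics theta c p Ht Hc Hd Hz) as [C [HC H]].
  exists C; split; [easy|]; intros eps B Heps.
  (* The first bound keeps [ER p n >= C / 2 * x] and the relative error at most 1/2; the second
     yields the final [eps]. *)
  set (e := Rmin (C / 2) (eps * C / 2)).
  assert (He0 : 0 < e).
  { apply Rmin_pos; [lra|]; pose proof (Rmult_lt_0_compat _ _ Heps HC); lra. }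
  assert (He1 : e <= C / 2) by apply Rmin_l.
  assert (He2 : e <= eps * C / 2) by apply Rmin_r.
  destruct (H e He0) as [N1 [HN1 HN1']].
  destruct (Rpower_scale_unbounded theta c (1 + 2 * Rabs B / C) Ht Hc) as [N2 [HN2 HN2']].
  exists (N1 + N2)%nat; split; [lia|]; intros n Hn x.
  specialize (HN1' n ltac:(lia)); specialize (HN2' n ltac:(lia)); fold x in HN1', HN2'.
  assert (HB : 0 <= 2 * Rabs B / C).
  { apply Rle_div_r; [easy|]; pose proof (Rabs_pos B); lra. }
  assert (Hs1 : 1 <= sqrt x) by (rewrite <- sqrt_1; apply sqrt_le_1_alt; lra).
  pose proof (sqrt_sqrt x ltac:(lra)) as Hss.
  assert (Hsx : e * sqrt x <= C / 2 * x).
  { apply Rmult_le_compat; try lra; nra. }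
  assert (HV : C / 2 * x <= ER p n <= 2 * C * x).
  { apply Rabs_le_between in HN1'; nra. }
  assert (HBx : B <= C / 2 * x).
  { assert (2 * Rabs B / C <= x) as HBC by lra. apply Rle_div_l in HBC; [|easy].
    pose proof (Rle_abs B); lra. }
  split; [lra|].
  assert (HCx : 0 < C * x) by nra.
  set (h := ER p n / (C * x) - 1).
  assert (Hh : Rabs h <= e / (C * sqrt x)).
  { unfold h; replace (ER p n / (C * x) - 1) with ((ER p n - C * x) / (C * x)) by (field; lra).
    rewrite Rabs_div, (Rabs_right (C * x)) by lra.
    apply Rle_div_l; [easy|].
    replace (e / (C * sqrt x) * (C * x)) with (e * sqrt x); [easy|].
    transitivity (e / (C * sqrt x) * (C * (sqrt x * sqrt x))); [field; lra | now rewrite Hss]. }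
  assert (Hh2 : e / (C * sqrt x) <= 1 / 2).
  { apply Rle_div_l; [nra|]; nra. }
  replace (ln (ER p n) - ln C - ln x) with (ln (1 + h)).
  2:{ unfold h; replace (1 + (ER p n / (C * x) - 1)) with (ER p n / (C * x)) by ring.
      rewrite ln_div, ln_mult by nra; ring. }
  eapply Rle_trans; [apply ln_near_1; lra|].
  apply Rle_trans with (2 * ((eps * C / 2) / (C * sqrt x))).
  - apply Rmult_le_compat_l; [lra|]. eapply Rle_trans; [apply Hh|].
    apply Rmult_le_compat_r; [|easy]. left; apply Rinv_0_lt_compat; nra.
  - right; field; lra.
Qed.

Lemma floorR_spec (x : R) : 0 <= x -> INR (floorR x) <= x < INR (floorR x) + 1.
Proof.
  intros Hx; unfold floorR; destruct (base_Int_part x) as [H1 H2].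
  assert (0 <= Int_part x)%Z.
  { enough (-1 < Int_part x)%Z by lia. apply lt_IZR; simpl; lra. }
  rewrite INR_IZR_INZ, Z2Nat.id by easy; lra.
Qed.

Lemma floorR_le (n : nat) (t : R) : 0 <= t <= 1 -> (floorR (INR n * t) <= n)%nat.
Proof.
  intros Ht; pose proof (pos_INR n).
  destruct (floorR_spec (INR n * t)) as [H1 _]; [nra|].
  apply INR_le; nra.
Qed.

(** The bias estimate, uniform on [delta, 1]. It has three errors: one of order [/ sqrt x] at [j],
    one at [n], and at most [/ INR j] for replacing [n t] by its floor. *)
Lemma ER_log_ratio (theta c delta : R) (p : nat -> R) :
  0 < theta < 1 -> 0 < c -> is_dict p -> near_zipf theta c p -> 0 < delta < 1 ->
  forall eps B, 0 < eps -> exists N, (1 <= N)%nat /\ forall n, (N <= n)%nat ->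
    B <= ER p n /\ forall t, delta <= t <= 1 ->
    let j := floorR (INR n * t) in
    (1 <= j)%nat /\ 1 <= ER p j /\
    sqrt (ER p n) * Rabs (ln (ER p j) - ln (ER p n) - theta * ln t) <= eps.
Proof.
  intros Ht Hc Hd Hz Hdl eps B Heps.
  destruct (ER_log_asymptotics theta c p ltac:(lra) Hc Hd Hz) as [C [HC H]].
  (* The two summands come from the errors at [j] and at [n]; together these use half of [eps]. *)
  set (Q := sqrt (2 * C) * (sqrt (2 / delta) + 1)).
  assert (Hd2 : 1 <= 2 / delta) by (apply Rle_div_r; lra).
  pose proof (sqrt_lt_R0 (2 * C) ltac:(lra)) as HsC.
  pose proof (sqrt_lt_R0 (2 / delta) ltac:(lra)) as Hsd.
  assert (HQ : 0 < Q) by (unfold Q; nra).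
  assert (He : 0 < eps / (2 * Q)) by (apply Rdiv_lt_0_compat; lra).
  destruct (H (eps / (2 * Q)) (Rmax 1 B) He) as [N0 [HN0 HN]]; clear H.
  set (e := eps / (2 * Q)) in *.
  (* [N1] ensures [[nt] >= n * delta / 2] and [[nt] >= N0]; [N2] below makes the floor error,
     multiplied by [sqrt (ER p n) <= sqrt n], at most [eps / 2]. *)
  destruct (nfloor_ex ((INR N0 + 2) * (2 / delta))) as [N1 [_ HN1]].
  { pose proof (pos_INR N0); nra. }
  destruct (nfloor_ex ((4 / (delta * eps)) ^ 2)) as [N2 [_ HN2]]; [apply pow2_ge_0|].
  exists (N0 + N1 + N2 + 1)%nat; split; [lia|]; intros n Hn.
  destruct (HN n ltac:(lia)) as [[HVn1 HVn2] HLn].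
  split; [eapply Rle_trans; [apply Rmax_r | apply HVn1]|].
  intros t Htt j.
  assert (Hn1 : 1 <= INR n) by (apply INR_ge_1; lia).
  assert (Hnd : INR N0 + 2 <= INR n * (delta / 2)).
  { assert (INR N1 + 1 <= INR n) by (rewrite <- S_INR; apply le_INR; lia).
    assert ((INR N0 + 2) * (2 / delta) <= INR n) as Hle by lra.
    apply (Rmult_le_compat_r (delta / 2)) in Hle; [|lra].
    replace ((INR N0 + 2) * (2 / delta) * (delta / 2)) with (INR N0 + 2) in Hle by (field; lra).
    lra. }
  destruct (floorR_spec (INR n * t)) as [Hj1 Hj2]; [nra|]; fold j in Hj1, Hj2.
  pose proof (pos_INR N0).
  assert (Hj3 : INR n * (delta / 2) <= INR j) by nra.
  assert (HjN : (N0 <= j)%nat) by (apply INR_le; lra).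
  destruct (HN j HjN) as [[HVj1 HVj2] HLj].
  pose proof (Rmax_l 1 B) as HR.
  split; [lia|]; split; [lra|].
  assert (Hj0 : 1 <= INR j) by (apply INR_ge_1; lia).
  set (xn := Rpower (c * INR n) theta) in *; set (xj := Rpower (c * INR j) theta) in *.
  assert (Hxn0 : 0 < xn) by apply Rpower_pos; assert (Hxj0 : 0 < xj) by apply Rpower_pos.
  (* Uses [theta < 1] and [2 / delta >= 1] to replace the power of [2 / delta] by [2 / delta]
     itself. *)
  assert (Hx : xn <= 2 / delta * xj).
  { apply Rle_trans with (Rpower (2 / delta * (c * INR j)) theta).
    - apply Rle_Rpower_l; [lra|]; split; [nra|].
      assert (INR n <= 2 / delta * INR j); [|nra].
      apply Rmult_le_reg_l with (delta / 2); [lra|].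
      replace (delta / 2 * (2 / delta * INR j)) with (INR j) by (field; lra); lra.
    - rewrite <- Rpower_mult_distr by nra. apply Rmult_le_compat_r; [now left|].
      rewrite <- (Rpower_1 (2 / delta)) at 2 by lra. apply Rle_Rpower; lra. }
  assert (Hsqx : sqrt xn <= sqrt (2 / delta) * sqrt xj).
  { rewrite <- sqrt_mult by lra; now apply sqrt_le_1_alt. }
  assert (Hsqv : sqrt (ER p n) <= sqrt (2 * C) * sqrt xn).
  { rewrite <- sqrt_mult by lra; apply sqrt_le_1_alt; lra. }
  assert (Hsqn : sqrt (ER p n) <= sqrt (INR n)) by (apply sqrt_le_1_alt; now apply ER_le_draws).
  pose proof (sqrt_lt_R0 _ Hxn0) as Hsn; pose proof (sqrt_lt_R0 _ Hxj0) as Hsj.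
  pose proof (sqrt_pos (ER p n)) as Hsv.
  set (Lj := ln (ER p j) - ln C - ln xj) in *; set (Ln := ln (ER p n) - ln C - ln xn) in *.
  assert (Ht0 : 0 < INR n * t) by nra.
  replace (ln (ER p j) - ln (ER p n) - theta * ln t) with
    (Lj + - Ln + - (theta * (ln (INR n * t) - ln (INR j)))).
  2:{ unfold Lj, Ln, xj, xn; rewrite !ln_Rpower, !ln_mult by lra; ring. }
  assert (Hfl : 0 <= ln (INR n * t) - ln (INR j) <= / INR j).
  { rewrite <- ln_div by lra.
    destruct (ln_bounds (INR n * t / INR j)) as [_ Hu]; [apply Rdiv_lt_0_compat; lra|].
    split.
    - rewrite <- ln_1; apply ln_le; [lra|]. apply Rle_div_r; lra.
    - eapply Rle_trans; [apply Hu|].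
      replace (INR n * t / INR j - 1) with ((INR n * t - INR j) / INR j) by (field; lra).
      rewrite <- (Rmult_1_l (/ INR j)); apply Rmult_le_compat_r; [|lra].
      left; apply Rinv_0_lt_compat; lra. }
  assert (Hab : Rabs (Lj + - Ln + - (theta * (ln (INR n * t) - ln (INR j))))
    <= e / sqrt xj + e / sqrt xn + / INR j).
  { eapply Rle_trans; [apply Rabs_triang|].
    rewrite (Rabs_Ropp (theta * _)), (Rabs_right (theta * _)) by nra.
    assert (theta * (ln (INR n * t) - ln (INR j)) <= / INR j) by nra.
    apply Rplus_le_compat; [|easy].
    eapply Rle_trans; [apply Rabs_triang|]; rewrite Rabs_Ropp; lra. }
  assert (A1 : sqrt (ER p n) * (e / sqrt xj) <= sqrt (2 * C) * sqrt (2 / delta) * e).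
  { apply Rle_trans with (sqrt (2 * C) * (sqrt (2 / delta) * sqrt xj) * (e / sqrt xj)).
    - apply Rmult_le_compat_r; [left; now apply Rdiv_lt_0_compat|]. nra.
    - right; field; lra. }
  assert (A2 : sqrt (ER p n) * (e / sqrt xn) <= sqrt (2 * C) * e).
  { apply Rle_trans with (sqrt (2 * C) * sqrt xn * (e / sqrt xn)).
    - apply Rmult_le_compat_r; [left; now apply Rdiv_lt_0_compat|]. easy.
    - right; field; lra. }
  assert (A3 : sqrt (ER p n) * / INR j <= eps / 2).
  { assert (Hsn2 : 4 / (delta * eps) <= sqrt (INR n)).
    { assert (Hde : 0 < delta * eps) by nra.
      rewrite <- (sqrt_pow2 (4 / (delta * eps))); [|left; apply Rdiv_lt_0_compat; lra].
      apply sqrt_le_1_alt.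
      assert (INR N2 + 1 <= INR n) by (rewrite <- S_INR; apply le_INR; lia). lra. }
    assert (Hde : 0 < delta * eps) by nra.
    apply Rle_div_l in Hsn2; [|easy].
    apply Rle_div_l; [lra|].
    pose proof (sqrt_sqrt (INR n) ltac:(lra)) as Hnn; pose proof (sqrt_pos (INR n)).
    assert (sqrt (INR n) <= eps / 2 * (INR n * (delta / 2))).
    { apply (Rmult_le_compat_r (sqrt (INR n) / 4)) in Hsn2; [|lra].
      set (u := sqrt (INR n)) in *; rewrite <- Hnn; lra. }
    assert (eps / 2 * (INR n * (delta / 2)) <= eps / 2 * INR j)
      by (apply Rmult_le_compat_l; lra).
    lra. }
  assert (A4 : e * Q = eps / 2) by (unfold e; field; lra).
  unfold Q in A4.
  eapply Rle_trans; [apply Rmult_le_compat_l; [easy | apply Hab]|]. lra.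
Qed.

Lemma ER_le_mono (p : nat -> R) (j n : nat) : is_dict p -> (j <= n)%nat -> ER p j <= ER p n.
Proof.
  intros Hd Hjn; apply ER_le; [easy|]; intros K.
  eapply Rle_trans; [|apply (ER_ge p n K Hd)].
  apply lsum_le; intros i Hi; apply in_seq in Hi; pose proof (dict_le_1 p i Hd ltac:(lia)).
  replace n with (j + (n - j))%nat by lia; rewrite pow_add.
  assert (0 <= (1 - p i) ^ j) by (apply pow_le; lra).
  assert (0 <= (1 - p i) ^ (n - j) <= 1).
  { pose proof (pow_incr (1 - p i) 1 (n - j) ltac:(lra)) as H1; rewrite pow1 in H1.
    split; [apply pow_le; lra | easy]. }
  nra.
Qed.

Lemma exp_near_0 (d : R) : Rabs d <= 1 -> Rabs (exp d - 1) <= 3 * Rabs d.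
Proof.
  intros Hd; pose proof (Rabs_pos d).
  pose proof (exp_ineq1_le d) as H1; pose proof (exp_ineq1_le (- d)) as H2.
  pose proof (exp_pos d).
  assert (H3 : exp d * exp (- d) = 1) by (rewrite <- exp_plus, Rplus_opp_r; apply exp_0).
  assert (H4 : exp d <= 3).
  { apply Rle_trans with (exp 1); [|apply exp_le_3].
    pose proof (Rle_abs d).
    destruct (Req_dec d 1) as [->|]; [lra | left; apply exp_increasing; lra]. }
  assert (exp d - 1 <= exp d * d) by nra.
  unfold Rabs in *; destruct (Rcase_abs d), (Rcase_abs (exp d - 1)); nra.
Qed.

(** To be read with r = R_[nt], v = E R_[nt] and V = E R_n. The coefficients 1, [3 / delta] and
    [36 / delta ^ 2] come from the bias, from replacing [V / v] by t^(-theta), and from the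
    quadratic remainder. Everything is measured by [1 + Z ^ 2] because only second moments of [Z]
    are controlled. *)
Lemma log_linearization (theta delta t r v V e : R) :
  0 < theta < 1 -> 0 < delta < 1 -> delta <= t <= 1 -> 1 <= r -> 1 <= v -> 0 < e <= 1 ->
  1 + (6 / e) ^ 4 <= V ->
  sqrt V * Rabs (ln v - ln V - theta * ln t) <= e ->
  let Z := (r - v) / sqrt V in
  Rabs (sqrt V * (ln r - ln V - theta * ln t) - Rpower t (- theta) * Z)
  <= e * (1 + 3 / delta + 36 / delta ^ 2) * (1 + Z ^ 2).
Proof.
  intros Ht Hdl Htt Hr Hv He HV Hd Z.
  assert (H6 : 0 < 6 / e) by (apply Rdiv_lt_0_compat; lra).
  assert (HV1 : 1 <= V) by (pose proof (pow_lt _ 4 H6); lra).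
  set (d := ln v - ln V - theta * ln t) in *.
  set (s := sqrt V) in *.
  assert (Hs1 : 1 <= s) by (unfold s; rewrite <- sqrt_1; apply sqrt_le_1_alt; lra).
  assert (Hss : s * s = V) by (apply sqrt_sqrt; lra).
  pose proof (Rabs_pos d) as Hd0.
  assert (Hde : Rabs d <= e) by nra.
  assert (Hlt : ln t <= 0) by (rewrite <- ln_1; apply ln_le; lra).
  set (tt := Rpower t (- theta)).
  assert (Htt0 : 0 < tt) by apply Rpower_pos.
  assert (HD : tt <= / delta).
  { apply Rle_trans with (/ t); [|apply Rinv_le_contravar; lra].
    unfold tt, Rpower; rewrite <- (exp_ln (/ t)) by (apply Rinv_0_lt_compat; lra).
    rewrite ln_Rinv by lra.
    destruct (Req_dec (- theta * ln t) (- ln t)) as [->|]; [lra|].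
    left; apply exp_increasing; nra. }
  set (D := / delta) in *.
  replace (3 / delta) with (3 * D) by (unfold D; field; lra).
  replace (36 / delta ^ 2) with (36 * (D * D)) by (unfold D; field; lra).
  (* The linear coefficient [V / v] differs from t^(-theta) exactly by the exponential of the
     bias. *)
  assert (HVv : V / v = tt * exp (- d)).
  { unfold tt, Rpower; rewrite <- exp_plus.
    replace (- theta * ln t + - d) with (ln V - ln v) by (unfold d; ring).
    rewrite <- ln_div by lra; rewrite exp_ln; [easy | apply Rdiv_lt_0_compat; lra]. }
  pose proof (exp_near_0 (- d)) as Hexp; rewrite Rabs_Ropp in Hexp; specialize (Hexp ltac:(lra)).
  assert (H1 : Rabs (V / v - tt) <= 3 * D * e).
  { rewrite HVv; replace (tt * exp (- d) - tt) with (tt * (exp (- d) - 1)) by ring.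
    rewrite Rabs_mult, (Rabs_right tt) by lra.
    apply Rle_trans with (D * (3 * e)); [|lra].
    apply Rmult_le_compat; try lra; apply Rabs_pos. }
  assert (H2 : 0 < V / v <= 3 * D).
  { split; [apply Rdiv_lt_0_compat; lra|]. rewrite HVv.
    assert (exp (- d) <= 3).
    { apply Rle_trans with (exp 1); [|apply exp_le_3].
      pose proof (Rle_abs (- d)); rewrite Rabs_Ropp in *.
      destruct (Req_dec (- d) 1) as [->|]; [lra | left; apply exp_increasing; lra]. }
    rewrite Rmult_comm; apply Rmult_le_compat; try lra. left; apply exp_pos. }
  (* Absorbs the logarithmic factor. With [q] the fourth root of [V],
     [1 + ln v <= 2 + ln V <= 4 * q - 2], and [6 / e <= q] makes this at most [e * q ^ 2]; hence the
     threshold [1 + (6 / e) ^ 4]. *)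
  assert (H3 : 1 + ln v <= s * e).
  { assert (Hlv : ln v <= ln V + 1).
    { assert (d <= 1) by (pose proof (Rle_abs d); lra). unfold d in *; nra. }
    set (q := sqrt s).
    assert (Hqq : q * q = s) by (apply sqrt_sqrt; lra).
    assert (Hq1 : 1 <= q) by (unfold q; rewrite <- sqrt_1; apply sqrt_le_1_alt; lra).
    assert (HlV : ln V <= 4 * (q - 1)).
    { rewrite <- Hss, <- Hqq, !ln_mult by nra.
      pose proof (ln_bounds q ltac:(lra)); lra. }
    assert (Hq6 : 6 / e <= q).
    { assert ((6 / e) ^ 2 <= s).
      { unfold s; rewrite <- (sqrt_pow2 ((6 / e) ^ 2)) by apply pow2_ge_0.
        apply sqrt_le_1_alt; rewrite <- pow_mult; simpl Nat.mul; lra. }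
      unfold q; rewrite <- (sqrt_pow2 (6 / e)) by lra. now apply sqrt_le_1_alt. }
    apply Rle_div_l in Hq6; [|lra]. rewrite <- Hqq; nra. }
  pose proof (ln_second_order r v Hr Hv) as H4.
  set (rem := ln r - ln v - (r / v - 1)) in *.
  assert (Hsz : r / v - 1 = Z * s / v) by (unfold Z; field; lra).
  assert (H5 : Rabs (s * rem) <= e * (36 * (D * D)) * Z ^ 2).
  { rewrite Rabs_mult, (Rabs_right s) by lra.
    apply Rle_trans with (s * (4 * (s * e) * (r / v - 1) ^ 2)).
    - apply Rmult_le_compat_l; [lra|]. eapply Rle_trans; [apply H4|].
      apply Rmult_le_compat_r; [apply pow2_ge_0 | lra].
    - rewrite Hsz.
      replace (s * (4 * (s * e) * (Z * s / v) ^ 2)) with (4 * e * Z ^ 2 * ((s * s / v) ^ 2))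
        by (field; lra).
      rewrite Hss.
      replace (e * (36 * (D * D)) * Z ^ 2) with (4 * e * Z ^ 2 * (3 * D) ^ 2) by ring.
      apply Rmult_le_compat_l; [pose proof (pow2_ge_0 Z); nra|].
      apply pow_incr; lra. }
  replace (s * (ln r - ln V - theta * ln t) - tt * Z) with
    (s * d + s * rem + Z * (V / v - tt)).
  2:{ unfold rem; rewrite Hsz; unfold d; rewrite <- Hss; field; lra. }
  assert (H6' : Rabs (s * d) <= e) by (rewrite Rabs_mult, (Rabs_right s); lra).
  assert (H7 : Rabs (Z * (V / v - tt)) <= (1 + Z ^ 2) * (3 * D * e)).
  { rewrite Rabs_mult; apply Rmult_le_compat; try apply Rabs_pos; [|easy].
    unfold Rabs; destruct (Rcase_abs Z); nra. }
  pose proof (pow2_ge_0 Z) as HZ.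
  assert (HD0 : 0 < D) by (apply Rinv_0_lt_compat; lra).
  eapply Rle_trans; [apply Rabs_triang|].
  eapply Rle_trans; [apply Rplus_le_compat_r, Rabs_triang|].
  assert (0 <= e * (D * D)) by (apply Rmult_le_pos; nra).
  nra.
Qed.

(** * Lebesgue-Stieltjes integrals *)

(* Coquelicot lemmas leave equations in a structure carrier, which [ring] does not see as [R]. *)
Ltac real_eq := match goal with |- ?x = ?y => change (@eq R x y) end.

Lemma Rint_RInt (f : R -> R) (a b : R) : ex_RInt f a b -> Rint f a b = RInt f a b.
Proof.
  intros H; unfold Rint.
  destruct (excluded_middle_informative _) as [He|He].
  - destruct (constructive_indefinite_description _ He) as [v [pr Hv]]; simpl.
    rewrite <- Hv; symmetry; apply RInt_Reals.
  - exfalso; apply He.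
    exists (RiemannInt (ex_RInt_Reals_0 _ _ _ H)), (ex_RInt_Reals_0 _ _ _ H); reflexivity.
Qed.

Lemma floorR_unique (x : R) (j : nat) : INR j <= x < INR j + 1 -> floorR x = j.
Proof.
  intros H; pose proof (pos_INR j); destruct (floorR_spec x ltac:(lra)) as [H1 H2].
  apply Nat.le_antisymm; apply Nat.lt_succ_r, INR_lt; rewrite S_INR; lra.
Qed.

(** The integrand is continuous between consecutive multiples of [1 / n]. These cells are glued from
    0 up to a multiple beyond [v], and the result is restricted to [[u, v]]. *)
Lemma ex_RInt_floor (n : nat) (h : nat -> R) (psi : R -> R) (u v : R) :
  (1 <= n)%nat -> (forall t, continuous psi t) -> 0 <= u <= v ->
  ex_RInt (fun t => h (floorR (INR n * t)) * psi t) u v.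
Proof.
  intros Hn Hpsi Huv; pose proof (INR_ge_1 n Hn).
  set (F := fun t => _).
  assert (HJ : forall J, ex_RInt F 0 (INR J / INR n)).
  { induction J as [|J IH].
    - simpl; unfold Rdiv; rewrite Rmult_0_l; apply ex_RInt_point.
    - apply ex_RInt_Chasles with (INR J / INR n); [exact IH|].
      assert (INR J / INR n <= INR (S J) / INR n).
      { apply Rmult_le_compat_r; [left; apply Rinv_0_lt_compat; lra | apply le_INR; lia]. }
      apply ex_RInt_ext with (fun t => scal (h J) (psi t)).
      + rewrite Rmin_left, Rmax_right by easy; intros t [Ht1 Ht2].
        apply Rlt_div_l in Ht1; [|lra]; apply Rlt_div_r in Ht2; [|lra]; rewrite S_INR in Ht2.
        unfold F; rewrite (floorR_unique _ J); [easy | lra].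
      + apply (@ex_RInt_scal R_NormedModule), (@ex_RInt_continuous R_CompleteNormedModule).
        intros; apply Hpsi. }
  destruct (nfloor_ex (v * INR n) ltac:(nra)) as [J [_ HJv]].
  assert (Hv : v <= INR (S J) / INR n) by (apply Rle_div_r; rewrite ?S_INR; lra).
  apply (@ex_RInt_Chasles_2 R_CompleteNormedModule) with 0; [easy|].
  apply (@ex_RInt_Chasles_1 R_CompleteNormedModule) with (INR (S J) / INR n); [lra | apply HJ].
Qed.

(** Extends a density known to be continuous only on its closed piece to a function continuous on
    the whole line. *)
Definition clamp (u v t : R) : R := Rmax u (Rmin v t).

Lemma clamp_bounds (u v t : R) : u <= v -> u <= clamp u v t <= v.
Proof.
  intros H; unfold clamp; split; [apply Rmax_l|].
  apply Rmax_lub; [easy | apply Rmin_l].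
Qed.

Lemma clamp_id (u v t : R) : u <= t <= v -> clamp u v t = t.
Proof. intros H; unfold clamp; rewrite Rmin_right, Rmax_right; lra. Qed.

Lemma continuous_of_lipschitz (f : R -> R) (t : R) :
  (forall s, Rabs (f s - f t) <= Rabs (s - t)) -> continuous f t.
Proof.
  intros Hf; apply continuity_pt_filterlim; intros e He; exists e; split; [easy|].
  intros s [_ Hs]; simpl in *; unfold Rfunctions.Rdist in *.
  eapply Rle_lt_trans; [apply Hf | exact Hs].
Qed.

Lemma continuous_clamp (u v t : R) : continuous (clamp u v) t.
Proof.
  apply continuous_of_lipschitz; intros s; unfold clamp, Rmax, Rmin, Rabs.
  repeat destruct (Rle_dec _ _); repeat destruct (Rcase_abs _); lra.
Qed.

Lemma continuous_Rmax_l (d t : R) : continuous (Rmax d) t.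
Proof.
  apply continuous_of_lipschitz; intros s; unfold Rmax, Rabs.
  repeat destruct (Rle_dec _ _); repeat destruct (Rcase_abs _); lra.
Qed.

(* A signed measure on [0,1] with density [D k] on the piece (a k, a (k+1)) and an atom of
   mass [J k] at [a k], carried by [delta,1]. *)
Record ls_weight (delta : R) (m : nat) (a : nat -> R) (D : nat -> R -> R) (J : nat -> R)
  : Prop := {
  lsw_delta : 0 < delta;
  lsw_grid : forall k, (k <= m)%nat -> 0 <= a k <= 1;
  lsw_incr : forall k, (k < m)%nat -> a k < a (S k);
  lsw_cont : forall k, (k < m)%nat -> forall t, a k <= t <= a (S k) -> continuous (D k) t;
  lsw_zero : forall k, (k < m)%nat -> forall t, a k < t < a (S k) -> t < delta -> D k t = 0;
  lsw_jump : forall k, (k <= m)%nat -> a k < delta -> J k = 0 }.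

(** Built from a density and jumps rather than from [A], so that absolute values of both give the
    integral against |dA|. *)
Definition LS (m : nat) (a : nat -> R) (D : nat -> R -> R) (J : nat -> R) (f : R -> R) : R :=
  lsum (fun k => RInt (fun t => f t * D k t) (a k) (a (S k))) (seq 0 m)
  + lsum (fun k => f (a k) * J k) (seq 0 (S m)).

Definition LSI (m : nat) (a : nat -> R) (D : nat -> R -> R) (f : R -> R) : Prop :=
  forall k, (k < m)%nat -> ex_RInt (fun t => f t * D k t) (a k) (a (S k)).

Lemma in_seq0 (k m : nat) : In k (seq 0 m) <-> (k < m)%nat.
Proof. rewrite in_seq; lia. Qed.

Lemma LSI_floor (delta : R) (m : nat) (a : nat -> R) (D : nat -> R -> R) (J : nat -> R)
  (n : nat) (h : nat -> R) (phi : R -> R) :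
  ls_weight delta m a D J -> (1 <= n)%nat -> (forall t, 0 < t -> continuous phi t) ->
  LSI m a D (fun t => phi t * h (floorR (INR n * t))).
Proof.
  intros HW Hn Hphi k Hk.
  pose proof (lsw_incr _ _ _ _ _ HW k Hk) as Hinc; pose proof (lsw_delta _ _ _ _ _ HW) as Hd.
  (* [phi] may be singular at 0, as the logarithm is; [Rmax delta] removes the singularity and
     changes the product only where the density vanishes. *)
  set (psi := fun t => phi (Rmax delta t) * D k (clamp (a k) (a (S k)) t)).
  apply ex_RInt_ext with (fun t => h (floorR (INR n * t)) * psi t).
  - rewrite Rmin_left, Rmax_right by lra; intros t Ht; unfold psi.
    rewrite clamp_id by lra.
    destruct (Rlt_dec t delta) as [Hlt|Hge].
    + rewrite (lsw_zero _ _ _ _ _ HW k Hk t Ht Hlt); real_eq; ring.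
    + rewrite Rmax_right by lra; real_eq; ring.
  - apply ex_RInt_floor; [easy| |split; [apply (lsw_grid _ _ _ _ _ HW); lia | lra]].
    intros t; unfold psi; apply (continuous_mult (K := R_AbsRing)).
    + apply (continuous_comp (Rmax delta) phi); [apply continuous_Rmax_l|].
      apply Hphi; pose proof (Rmax_l delta t); lra.
    + apply (continuous_comp (clamp (a k) (a (S k))) (D k)); [apply continuous_clamp|].
      apply (lsw_cont _ _ _ _ _ HW k Hk), clamp_bounds; lra.
Qed.

Lemma LSI_plus (m : nat) (a : nat -> R) (D : nat -> R -> R) (f1 f2 : R -> R) :
  LSI m a D f1 -> LSI m a D f2 -> LSI m a D (fun t => f1 t + f2 t).
Proof.
  intros H1 H2 k Hk.
  apply ex_RInt_ext with (fun t => plus (f1 t * D k t) (f2 t * D k t)).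
  - intros t _; unfold plus; simpl; real_eq; ring.
  - apply (@ex_RInt_plus R_NormedModule); [now apply H1 | now apply H2].
Qed.

Lemma LSI_scal (m : nat) (a : nat -> R) (D : nat -> R -> R) (f : R -> R) (r : R) :
  LSI m a D f -> LSI m a D (fun t => r * f t).
Proof.
  intros H k Hk.
  apply ex_RInt_ext with (fun t => scal r (f t * D k t)).
  - intros t _; unfold scal; simpl; unfold mult; simpl; real_eq; ring.
  - apply (@ex_RInt_scal R_NormedModule); now apply H.
Qed.

Lemma LS_plus (m : nat) (a : nat -> R) (D : nat -> R -> R) (J : nat -> R) (f1 f2 : R -> R) :
  LSI m a D f1 -> LSI m a D f2 ->
  LS m a D J (fun t => f1 t + f2 t) = LS m a D J f1 + LS m a D J f2.
Proof.
  intros H1 H2; unfold LS.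
  rewrite (lsum_ext (fun k => RInt (fun t => (f1 t + f2 t) * D k t) (a k) (a (S k)))
    (fun k => RInt (fun t => f1 t * D k t) (a k) (a (S k))
            + RInt (fun t => f2 t * D k t) (a k) (a (S k)))).
  2:{ intros k Hk; apply in_seq0 in Hk.
      rewrite <- (@RInt_plus R_CompleteNormedModule) by (apply H1 || apply H2; easy).
      apply RInt_ext; intros t _; unfold plus; simpl; real_eq; ring. }
  rewrite (lsum_ext (fun k => (f1 (a k) + f2 (a k)) * J k)
    (fun k => f1 (a k) * J k + f2 (a k) * J k)) by (intros; ring).
  rewrite !lsum_plus; ring.
Qed.

Lemma LS_scal (m : nat) (a : nat -> R) (D : nat -> R -> R) (J : nat -> R) (f : R -> R) (r : R) :
  LSI m a D f -> LS m a D J (fun t => r * f t) = r * LS m a D J f.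
Proof.
  intros H; unfold LS.
  rewrite (lsum_ext (fun k => RInt (fun t => r * f t * D k t) (a k) (a (S k)))
    (fun k => r * RInt (fun t => f t * D k t) (a k) (a (S k)))).
  2:{ intros k Hk; apply in_seq0 in Hk.
      rewrite <- (@RInt_scal R_CompleteNormedModule) by (apply H; easy).
      apply RInt_ext; intros t _; unfold scal; simpl; unfold mult; simpl; real_eq; ring. }
  rewrite (lsum_ext (fun k => r * f (a k) * J k) (fun k => r * (f (a k) * J k)))
    by (intros; ring).
  rewrite !lsum_scal; ring.
Qed.

(** Fubini for a truncated expectation: with [c] the word weights, the sum over words moves inside
    the integral. *)
Lemma LS_lsum {X : Type} (m : nat) (a : nat -> R) (D : nat -> R -> R) (J : nat -> R)
  (c : X -> R) (F : X -> R -> R) (l : list X) :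
  (forall x, LSI m a D (F x)) ->
  LSI m a D (fun t => lsum (fun x => c x * F x t) l) /\
  lsum (fun x => c x * LS m a D J (F x)) l = LS m a D J (fun t => lsum (fun x => c x * F x t) l).
Proof.
  intros HF; induction l as [|x l [IH1 IH2]]; simpl.
  - split.
    + intros k Hk; apply ex_RInt_ext with (fun _ => 0); [intros; real_eq; ring | apply ex_RInt_const].
    + unfold LS.
      rewrite (lsum_ext (fun k => RInt _ _ _) (fun _ => 0)).
      2:{ intros k _; rewrite (RInt_ext _ (fun _ => 0)) by (intros; real_eq; ring).
          rewrite RInt_const; unfold scal; simpl; unfold mult; simpl; real_eq; ring. }
      rewrite (lsum_ext (fun k => 0 * J k) (fun _ => 0)) by (intros; real_eq; ring).
      rewrite !lsum_const; ring.
  - split.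
    + apply LSI_plus; [now apply LSI_scal | exact IH1].
    + rewrite IH2, LS_plus, LS_scal; auto. now apply LSI_scal.
Qed.

Lemma ls_weight_abs (delta : R) (m : nat) (a : nat -> R) (D : nat -> R -> R) (J : nat -> R) :
  ls_weight delta m a D J ->
  ls_weight delta m a (fun k t => Rabs (D k t)) (fun k => Rabs (J k)).
Proof.
  intros [H1 H2 H3 H4 H5 H6]; constructor; auto.
  - intros k Hk t Ht; apply (continuous_comp (D k) Rabs); [auto | apply continuous_Rabs].
  - intros k Hk t Ht Hlt; rewrite H5 by easy; apply Rabs_R0.
  - intros k Hk Hlt; rewrite H6 by easy; apply Rabs_R0.
Qed.

Lemma LS_le (delta : R) (m : nat) (a : nat -> R) (D : nat -> R -> R) (J : nat -> R)
  (f1 f2 : R -> R) :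
  ls_weight delta m a D J -> (forall k t, 0 <= D k t) -> (forall k, 0 <= J k) ->
  LSI m a D f1 -> LSI m a D f2 -> (forall t, delta <= t <= 1 -> f1 t <= f2 t) ->
  LS m a D J f1 <= LS m a D J f2.
Proof.
  intros HW HD HJ H1 H2 Hle; unfold LS; apply Rplus_le_compat; apply lsum_le; intros k Hk;
    apply in_seq0 in Hk.
  - pose proof (lsw_incr _ _ _ _ _ HW k Hk).
    pose proof (lsw_grid _ _ _ _ _ HW (S k) ltac:(lia)).
    apply RInt_le; [lra | now apply H1 | now apply H2|]; intros t Ht.
    destruct (Rlt_dec t delta) as [Hlt|Hge].
    + rewrite (lsw_zero _ _ _ _ _ HW k Hk t Ht Hlt); lra.
    + apply Rmult_le_compat_r; [apply HD | apply Hle; lra].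
  - pose proof (lsw_grid _ _ _ _ _ HW k ltac:(lia)).
    destruct (Rlt_dec (a k) delta) as [Hlt|Hge].
    + rewrite (lsw_jump _ _ _ _ _ HW k ltac:(lia) Hlt); lra.
    + apply Rmult_le_compat_r; [apply HJ | apply Hle; lra].
Qed.

Lemma LS_abs_le (delta : R) (m : nat) (a : nat -> R) (D : nat -> R -> R) (J : nat -> R)
  (f1 f2 : R -> R) :
  ls_weight delta m a D J ->
  LSI m a D f1 -> LSI m a (fun k t => Rabs (D k t)) f2 ->
  (forall t, delta <= t <= 1 -> Rabs (f1 t) <= f2 t) ->
  Rabs (LS m a D J f1) <= LS m a (fun k t => Rabs (D k t)) (fun k => Rabs (J k)) f2.
Proof.
  intros HW H1 H2 Hle; unfold LS.
  eapply Rle_trans; [apply Rabs_triang|].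
  apply Rplus_le_compat; (eapply Rle_trans; [apply lsum_Rabs|]); apply lsum_le; intros k Hk;
    apply in_seq0 in Hk.
  - pose proof (lsw_incr _ _ _ _ _ HW k Hk).
    pose proof (lsw_grid _ _ _ _ _ HW (S k) ltac:(lia)).
    eapply Rle_trans; [apply abs_RInt_le; [lra | now apply H1]|].
    apply RInt_le; [lra | | now apply H2|].
    + apply ex_RInt_ext with (fun t => norm (f1 t * D k t)); [easy|].
      apply ex_RInt_norm; now apply H1.
    + intros t Ht; rewrite Rabs_mult.
      destruct (Rlt_dec t delta) as [Hlt|Hge].
      * rewrite (lsw_zero _ _ _ _ _ HW k Hk t Ht Hlt), Rabs_R0; lra.
      * apply Rmult_le_compat_r; [apply Rabs_pos | apply Hle; lra].
  - pose proof (lsw_grid _ _ _ _ _ HW k ltac:(lia)). rewrite Rabs_mult.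
    destruct (Rlt_dec (a k) delta) as [Hlt|Hge].
    + rewrite (lsw_jump _ _ _ _ _ HW k ltac:(lia) Hlt), Rabs_R0; lra.
    + apply Rmult_le_compat_r; [apply Rabs_pos | apply Hle; lra].
Qed.

(** * From the weight [A] to its density and jumps *)

Definition jump (A : R -> R) (m : nat) (a : nat -> R) (g : nat -> R -> R) (k : nat) : R :=
  A_right A m a g k - A_left A a g k.

Lemma lsum_seq0_sum_f_R0 (f : nat -> R) (m : nat) :
  lsum f (seq 0 (S m)) = sum_f_R0 f m.
Proof.
  induction m as [|m IH]; [simpl; ring|].
  rewrite seq_S, lsum_app, IH; simpl; ring.
Qed.

Lemma LSint_LS (A : R -> R) (m : nat) (a : nat -> R) (g dg : nat -> R -> R) (f : R -> R) :
  LSI m a dg f -> LSint A m a g dg f = LS m a dg (jump A m a g) f.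
Proof.
  intros H; unfold LSint, LS; f_equal.
  - destruct m as [|m]; [easy|].
    rewrite <- lsum_seq0_sum_f_R0; apply lsum_ext; intros k Hk; apply in_seq0 in Hk.
    now apply Rint_RInt, H.
  - now rewrite <- lsum_seq0_sum_f_R0.
Qed.

Lemma continuity_pt_vanish (h : R -> R) (x : R) :
  continuity_pt h x ->
  (forall e, 0 < e -> exists t, t <> x /\ Rabs (t - x) < e /\ h t = 0) -> h x = 0.
Proof.
  intros Hc H; apply NNPP; intros Hx.
  destruct (Hc (Rabs (h x)) (Rabs_pos_lt _ Hx)) as [e [He Hlim]].
  destruct (H e He) as [t [Htx [Hte Ht]]].
  specialize (Hlim t); simpl in Hlim; unfold Rfunctions.Rdist, D_x, no_cond in Hlim.
  rewrite Ht, Rminus_0_l, Rabs_Ropp in Hlim.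
  apply (Rlt_irrefl (Rabs (h x))), Hlim; auto.
Qed.

Lemma PwC1_grid (A : R -> R) (m : nat) (a : nat -> R) (g dg : nat -> R -> R) :
  PwC1 A m a g dg -> forall k, (k <= m)%nat -> 0 <= a k <= 1.
Proof.
  intros (Hm & Ha0 & Ham & Hinc & _) k Hk.
  assert (Hmono : forall i j, (i + j <= m)%nat -> a i <= a (i + j)%nat).
  { intros i j; induction j as [|j IH]; intros Hij; [rewrite Nat.add_0_r; lra|].
    rewrite Nat.add_succ_r; specialize (Hinc (i + j)%nat ltac:(lia)); specialize (IH ltac:(lia)); lra. }
  pose proof (Hmono 0%nat k ltac:(lia)); pose proof (Hmono k (m - k)%nat ltac:(lia)).
  replace (k + (m - k))%nat with m in H0 by lia; simpl in H; lra.
Qed.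

(** Below [delta] each [g k] coincides with [A = 0] on its open piece, so its derivative vanishes
    there, and by continuity so do the one-sided limits at the breakpoints. *)
Lemma PwC1_weight (A : R -> R) (m : nat) (a : nat -> R) (g dg : nat -> R -> R) (delta : R) :
  PwC1 A m a g dg -> 0 < delta < 1 -> (forall t, 0 <= t <= delta -> A t = 0) ->
  ls_weight delta m a dg (jump A m a g).
Proof.
  intros HP Hd HA; pose proof (PwC1_grid A m a g dg HP) as Hgrid.
  destruct HP as (Hm & Ha0 & Ham & Hinc & Hder & Hg).
  assert (Hcont : forall k, (k < m)%nat -> forall t, a k <= t <= a (S k) -> continuity_pt (g k) t).
  { intros k Hk t Ht; apply derivable_continuous_pt; exists (dg k t); now apply Hder. }
  assert (Hg0 : forall k, (k < m)%nat -> forall t, a k < t < a (S k) -> t < delta -> g k t = 0).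
  { intros k Hk t Ht Hlt; rewrite <- Hg by easy; apply HA.
    pose proof (Hgrid k ltac:(lia)); lra. }
  constructor; auto; [lra| | |].
  - intros k Hk t Ht; apply continuity_pt_filterlim; now apply Hder.
  - intros k Hk t Ht Hlt.
    assert (H1 : is_derive (g k) t (dg k t)) by (apply is_derive_Reals, Hder; [easy | lra]).
    assert (H2 : is_derive (g k) t 0).
    { apply (is_derive_ext_loc (fun _ => 0)); [|apply (is_derive_const (V := R_NormedModule) 0)].
      assert (He : 0 < Rmin (t - a k) (Rmin (a (S k) - t) (delta - t)))
        by (repeat apply Rmin_pos; lra).
      exists (mkposreal _ He); intros y Hy; symmetry; simpl in Hy.
      unfold ball in Hy; simpl in Hy; unfold AbsRing_ball, abs, minus, plus, opp in Hy; simpl in Hy.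
      pose proof (Rmin_l (t - a k) (Rmin (a (S k) - t) (delta - t))).
      pose proof (Rmin_r (t - a k) (Rmin (a (S k) - t) (delta - t))).
      pose proof (Rmin_l (a (S k) - t) (delta - t)); pose proof (Rmin_r (a (S k) - t) (delta - t)).
      apply Rabs_def2 in Hy; apply Hg0; [easy | lra | lra]. }
    now rewrite <- (is_derive_unique _ _ _ H1), (is_derive_unique _ _ _ H2).
  - intros k Hk Hlt.
    (* The last breakpoint is 1, hence not below [delta]. *)
    assert (Hkm : (k < m)%nat).
    { destruct (Nat.eq_dec k m) as [->|]; [lra | lia]. }
    assert (HR : A_right A m a g k = 0).
    { unfold A_right; rewrite (proj2 (Nat.ltb_lt k m) Hkm).
      pose proof (Hinc k Hkm).
      apply continuity_pt_vanish; [apply Hcont; [easy | lra]|]; intros e He.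
      set (u := Rmin e (Rmin (a (S k) - a k) (delta - a k))).
      assert (Hu : 0 < u) by (repeat apply Rmin_pos; lra).
      assert (u <= e) by apply Rmin_l.
      assert (u <= Rmin (a (S k) - a k) (delta - a k)) by apply Rmin_r.
      pose proof (Rmin_l (a (S k) - a k) (delta - a k)).
      pose proof (Rmin_r (a (S k) - a k) (delta - a k)).
      exists (a k + u / 2); split; [lra|]; split.
      - apply Rabs_def1; lra.
      - apply Hg0; [easy | lra | lra]. }
    assert (HL : A_left A a g k = 0).
    { destruct k as [|j]; simpl; [apply HA; rewrite Ha0; lra|].
      pose proof (Hinc j ltac:(lia)).
      apply continuity_pt_vanish; [apply Hcont; [lia | lra]|]; intros e He.
      set (u := Rmin e (a (S j) - a j)).
      assert (Hu : 0 < u) by (apply Rmin_pos; lra).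
      assert (u <= e) by apply Rmin_l.
      assert (u <= a (S j) - a j) by apply Rmin_r.
      exists (a (S j) - u / 2); split; [lra|]; split.
      - apply Rabs_def1; lra.
      - apply Hg0; [lia | lra | lra]. }
    unfold jump; lra.
Qed.

Lemma lsum_seq0_S (f : nat -> R) (m : nat) :
  lsum f (seq 0 (S m)) = lsum f (seq 0 m) + f m.
Proof. rewrite seq_S, lsum_app; simpl; ring. Qed.

Lemma lsum_seq0_shift (f : nat -> R) (m : nat) :
  lsum f (seq 0 (S m)) = f 0%nat + lsum (fun k => f (S k)) (seq 0 m).
Proof. simpl; rewrite <- seq_shift, lsum_map; ring. Qed.

(** The increments of the [g k] cancel against the one-sided limits in the jumps, leaving only the
    conventional outer values at 0 and 1. With [A 0 = A 1 = 0], constants integrate to 0. *)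
Lemma LS_mass (A : R -> R) (m : nat) (a : nat -> R) (g dg : nat -> R -> R) :
  PwC1 A m a g dg -> LS m a dg (jump A m a g) (fun _ => 1) = A 1 - A 0.
Proof.
  intros (Hm & Ha0 & Ham & Hinc & Hder & _); unfold LS.
  rewrite (lsum_ext _ (fun k => g k (a (S k)) - g k (a k))).
  2:{ intros k Hk; apply in_seq0 in Hk; pose proof (Hinc k Hk).
      apply is_RInt_unique, (is_RInt_ext (dg k)); [intros; real_eq; ring|].
      apply (is_RInt_derive (V := R_CompleteNormedModule) (g k) (dg k));
        rewrite Rmin_left, Rmax_right by lra; intros t Ht.
      - apply is_derive_Reals; now apply Hder.
      - apply continuity_pt_filterlim; now apply Hder. }
  rewrite (lsum_ext (fun k => 1 * jump A m a g k) (fun k => A_right A m a g k - A_left A a g k))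
    by (intros; unfold jump; ring).
  rewrite !lsum_minus, (lsum_seq0_S (A_right A m a g)), (lsum_seq0_shift (A_left A a g)).
  simpl A_left.
  rewrite (lsum_ext (A_right A m a g) (fun k => g k (a k))).
  2:{ intros k Hk; apply in_seq0 in Hk; unfold A_right.
      now rewrite (proj2 (Nat.ltb_lt k m) Hk). }
  unfold A_right; rewrite Nat.ltb_irrefl, Ha0, Ham; ring.
Qed.

(** * Convergence in probability *)

(** Markov's inequality holds for each nonnegative truncated sum, and [seq_lim_bounds] transfers the
    bound to [Prob]. *)
Lemma Prob_markov (p : nat -> R) (n K0 : nat) (X : list nat -> R) (eps B : R) :
  is_dict p -> 0 < eps -> 0 <= B ->
  (forall K, (K0 <= K)%nat -> trunc_E p n K (fun w => Rabs (X w)) <= B) ->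
  0 <= Prob p n (fun w => eps < Rabs (X w)) <= B / eps.
Proof.
  intros Hd He HB H; unfold Prob, Expect; apply (seq_lim_bounds _ _ K0).
  - apply Rle_div_r; lra.
  - intros K HK; split.
    + apply Rle_trans with (trunc_E p n K (fun _ => 0 * 1)); [rewrite trunc_E_scal; lra|].
      apply trunc_E_le; [apply Hd|]; intros w _; cbv beta; destruct (excluded_middle_informative _); lra.
    + apply Rle_trans with (trunc_E p n K (fun w => / eps * Rabs (X w))).
      * apply trunc_E_le; [apply Hd|]; intros w _; pose proof (Rabs_pos (X w)).
        assert (0 < / eps) by now apply Rinv_0_lt_compat.
        destruct (excluded_middle_informative _); [|nra].
        rewrite Rmult_comm; apply Rle_div_r; lra.
      * rewrite trunc_E_scal, Rmult_comm.
        apply Rmult_le_compat_r; [left; now apply Rinv_0_lt_compat | now apply H].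
Qed.

(** Lets [logp] be replaced by [ln] and supplies the hypothesis [1 <= r] of the logarithmic
    estimates. *)
Lemma Rdist_ge_1 (n K j : nat) (w : list nat) :
  In w (words n K) -> (1 <= j)%nat -> (1 <= n)%nat -> 1 <= INR (Defs.Rdist j w).
Proof.
  intros Hw Hj Hn; destruct (words_spec n K w Hw) as [Hlen _].
  destruct w as [|x w]; [simpl in Hlen; lia|]; destruct j as [|j]; [lia|].
  apply INR_ge_1; unfold Defs.Rdist.
  destruct (nodup Nat.eq_dec (firstn (S j) (x :: w))) as [|y l] eqn:E; [|simpl; lia].
  assert (Hx : In x (nodup Nat.eq_dec (firstn (S j) (x :: w)))) by (apply nodup_In; now left).
  now rewrite E in Hx.
Qed.

Lemma logp_ln (r : R) : 1 <= r -> logp r = ln r.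
Proof.
  intros Hr; unfold logp; destruct (Rlt_dec 1 r); [easy|].
  replace r with 1 by lra; now rewrite ln_1.
Qed.

Lemma continuous_ln_pos (t : R) : 0 < t -> continuous ln t.
Proof.
  intros Ht; apply (ex_derive_continuous ln); exists (/ t).
  now apply is_derive_Reals, derivable_pt_lim_ln.
Qed.

Lemma continuous_Rpower (y t : R) : 0 < t -> continuous (fun s => Rpower s y) t.
Proof.
  intros Ht; apply (ex_derive_continuous (fun s => Rpower s y)).
  exists (y * Rpower t (y - 1)); now apply is_derive_Reals, derivable_pt_lim_power.
Qed.

(** Zero total mass allows subtracting the constant [ln (ER p n)] under the integral, and the
    normalization of [ln] writes [theta] as the integral of [theta * ln t]; the whole error becomes
    one integral. *)
Lemma theta_hat_linearized
  (theta delta : R) (p : nat -> R)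
  (A : R -> R) (m : nat) (a : nat -> R) (g dg : nat -> R -> R) (n : nat) (w : list nat) :
  PwC1 A m a g dg -> LSint A m a g dg ln = 1 -> A 0 = 0 -> A 1 = 0 ->
  0 < delta < 1 -> (forall t, 0 <= t <= delta -> A t = 0) -> (1 <= n)%nat ->
  let f := fun t =>
    sqrt (ER p n) * (logp (INR (Defs.Rdist (floorR (INR n * t)) w))
                     - ln (ER p n) - theta * ln t)
    - Rpower t (- theta) * Zn p n t w in
  LSI m a dg f /\
  sqrt (ER p n) * (theta_hat A m a g dg n w - theta)
    - LSint A m a g dg (fun t => Rpower t (- theta) * Zn p n t w)
  = LS m a dg (jump A m a g) f.
Proof.
  intros HP Hln HA0 HA1 Hd HA Hn f.
  pose proof (PwC1_weight A m a g dg delta HP Hd HA) as HW.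
  set (J := jump A m a g) in *.
  set (L := fun t => logp (INR (Defs.Rdist (floorR (INR n * t)) w))).
  set (z := fun t => Rpower t (- theta) * Zn p n t w).
  assert (IL : LSI m a dg L).
  { pose proof (LSI_floor delta m a dg J n (fun j => logp (INR (Defs.Rdist j w))) (fun _ => 1)
      HW Hn ltac:(intros; apply continuous_const)) as H.
    intros k Hk; eapply ex_RInt_ext; [|apply (H k Hk)]. intros t _; unfold L; simpl; real_eq; ring. }
  assert (I1 : LSI m a dg (fun _ => 1)).
  { pose proof (LSI_floor delta m a dg J n (fun _ => 1) (fun _ => 1)
      HW Hn ltac:(intros; apply continuous_const)) as H.
    intros k Hk; eapply ex_RInt_ext; [|apply (H k Hk)]. intros t _; simpl; real_eq; ring. }
  assert (Iln : LSI m a dg ln).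
  { pose proof (LSI_floor delta m a dg J n (fun _ => 1) ln HW Hn continuous_ln_pos) as H.
    intros k Hk; eapply ex_RInt_ext; [|apply (H k Hk)]. intros t _; simpl; real_eq; ring. }
  assert (Iz : LSI m a dg z).
  { apply (LSI_floor delta m a dg J n
      (fun j => (INR (Defs.Rdist j w) - ER p j) / sqrt (ER p n)) (fun t => Rpower t (- theta)) HW Hn).
    apply continuous_Rpower. }
  rewrite LSint_LS in Hln by easy.
  pose proof (LS_mass A m a g dg HP) as H1; rewrite HA0, HA1, Rminus_0_r in H1.
  unfold theta_hat; rewrite 2!LSint_LS by easy.
  fold J L z in Hln, H1 |- *.
  set (s := sqrt (ER p n)) in *.
  set (f1 := fun t => s * L t + (- (s * ln (ER p n))) * 1).
  set (f2 := fun t => (- (s * theta)) * ln t + (- 1) * z t).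
  set (f' := fun t => f1 t + f2 t).
  assert (Eff : forall t, f' t = f t) by (intros t; unfold f', f1, f2, f, L, z; fold s; ring).
  pose proof (LSI_scal m a dg L s IL) as IL'.
  pose proof (LSI_scal m a dg _ (- (s * ln (ER p n))) I1) as I1'.
  pose proof (LSI_scal m a dg ln (- (s * theta)) Iln) as Iln'.
  pose proof (LSI_scal m a dg z (- 1) Iz) as Iz'.
  assert (If1 : LSI m a dg f1) by now apply LSI_plus.
  assert (If2 : LSI m a dg f2) by now apply LSI_plus.
  assert (If' : LSI m a dg f') by now apply LSI_plus.
  split.
  - intros k Hk; apply ex_RInt_ext with (fun t => f' t * dg k t); [|now apply If'].
    intros t _; now rewrite Eff.
  - transitivity (LS m a dg J f').
    + unfold f'; rewrite (LS_plus m a dg J f1 f2 If1 If2).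
      unfold f1; rewrite (LS_plus m a dg J _ _ IL' I1').
      unfold f2; rewrite (LS_plus m a dg J _ _ Iln' Iz').
      rewrite (LS_scal m a dg J L s IL), (LS_scal m a dg J _ _ I1),
        (LS_scal m a dg J ln _ Iln), (LS_scal m a dg J z _ Iz), H1, Hln; ring.
    + unfold LS; f_equal; apply lsum_ext; intros k _; [apply RInt_ext; intros t _|];
        now rewrite Eff.
Qed.

Theorem theorem2p2
  (theta c delta : R) (p : nat -> R)
  (A : R -> R) (m : nat) (a : nat -> R) (g dg : nat -> R -> R) :
  0 < theta < 1 ->
  0 < c ->
  (forall i, (1 <= i)%nat -> 0 < p i) ->
  infinite_sum (fun i => p (S i)) 1 ->
  (* p_i = c i^{-1/theta} (1 + o(i^{-1/2})) *)
  Un_cv (fun i => (p (S i) / (c * Rpower (INR (S i)) (- / theta)) - 1)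
                  * sqrt (INR (S i))) 0 ->
  (* A : step + piecewise C^1 on [0,1] *)
  PwC1 A m a g dg ->
  LSint A m a g dg ln = 1 ->
  A 0 = 0 ->
  (forall eps, 0 < eps -> exists eta, 0 < eta /\
       forall t, 0 < t < eta -> Rabs (A t) < eps) ->
  A 1 = 0 ->
  0 < delta < 1 ->
  (forall t, 0 <= t <= delta -> A t = 0) ->
  forall eps, 0 < eps ->
    Un_cv (fun n => Prob p n (fun w =>
       eps < Rabs (sqrt (ER p n) * (theta_hat A m a g dg n w - theta)
                   - LSint A m a g dg (fun t => Rpower t (- theta) * Zn p n t w)))) 0.
Proof.
  intros Htheta Hc Hp Hsum Hzipf HP Hln HA0 _ HA1 Hd HA eps Heps eta Heta.
  assert (Hdict : is_dict p) by now split.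
  pose proof (PwC1_weight A m a g dg delta HP Hd HA) as HW.
  set (J := jump A m a g) in *.
  pose proof (ls_weight_abs _ _ _ _ _ HW) as HWa.
  set (Da := fun k t => Rabs (dg k t)) in *; set (Ja := fun k => Rabs (J k)) in *.
  assert (Iconst : forall r, LSI m a Da (fun _ => r)).
  { intros r k Hk.
    eapply ex_RInt_ext; [|apply (LSI_floor delta m a Da Ja 1 (fun _ => 1) (fun _ => r)
      HWa ltac:(lia) ltac:(intros; apply continuous_const) k Hk)].
    intros t _; simpl; real_eq; ring. }
  (* The total variation of [A]. *)
  set (TV := LS m a Da Ja (fun _ => 1)).
  assert (HTV : 0 <= TV).
  { apply Rle_trans with (LS m a Da Ja (fun _ => 0 * 1)).
    - rewrite LS_scal by apply Iconst; lra.
    - apply (LS_le delta); auto; try (intros; apply Rabs_pos); intros; lra. }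
  set (Q := 1 + 3 / delta + 36 / delta ^ 2).
  assert (HQ : 0 < Q).
  { unfold Q; assert (0 < 3 / delta) by (apply Rdiv_lt_0_compat; lra).
    assert (0 < 36 / delta ^ 2) by (apply Rdiv_lt_0_compat; [lra | apply pow_lt; lra]). lra. }
  assert (Hden : 0 < 6 * Q * (TV + 1)) by (apply Rmult_lt_0_compat; lra).
  (* The final bound is [3 * e * Q * TV / eps]; the constant 6 makes it at most [eta / 2], and
     [TV + 1] avoids a division by 0. *)
  set (e := Rmin 1 (eta * eps / (6 * Q * (TV + 1)))).
  assert (He0 : 0 < e).
  { apply Rmin_pos; [lra|]; apply Rdiv_lt_0_compat; [nra | easy]. }
  assert (He1 : e <= 1) by apply Rmin_l.
  assert (He2 : e * (6 * Q * (TV + 1)) <= eta * eps) by (apply Rle_div_r; [easy | apply Rmin_r]).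
  destruct (ER_log_ratio theta c delta p Htheta Hc Hdict Hzipf Hd e (1 + (6 / e) ^ 4) He0)
    as [N [HN1 HN]].
  exists N; intros n Hn; destruct (HN n Hn) as [HV Hratio]; clear HN.
  assert (Hn1 : (1 <= n)%nat) by lia.
  set (V := ER p n) in *; set (s := sqrt V) in *.
  assert (HV1 : 1 <= V).
  { assert (0 < 6 / e) by (apply Rdiv_lt_0_compat; lra). pose proof (pow_lt _ 4 H); lra. }
  assert (Hs : 0 < s) by (apply sqrt_lt_R0; lra).
  assert (Hss : s * s = V) by (apply sqrt_sqrt; lra).
  destruct (trunc_E_variance p n Hdict) as [K0 HK0].
  set (X := fun w => s * (theta_hat A m a g dg n w - theta)
                   - LSint A m a g dg (fun t => Rpower t (- theta) * Zn p n t w)).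
  set (H := fun w t => 1 + Zn p n t w ^ 2).
  assert (IH : forall w, LSI m a Da (H w)).
  { intros w k Hk.
    eapply ex_RInt_ext; [|apply (LSI_floor delta m a Da Ja n
      (fun j => 1 + ((INR (Defs.Rdist j w) - ER p j) / s) ^ 2) (fun _ => 1)
        HWa Hn1 ltac:(intros; apply continuous_const) k Hk)].
    intros t _; simpl; unfold H, Zn; fold V s; real_eq; simpl; ring. }
  (* A pathwise bound, valid for every word list: randomness enters only through [Zn ^ 2] inside
     [H]. *)
  assert (HX : forall K w, In w (words n K) -> Rabs (X w) <= (e * Q) * LS m a Da Ja (H w)).
  { intros K w Hw.
    destruct (theta_hat_linearized theta delta p A m a g dg n w HP Hln HA0 HA1 Hd HA Hn1)
      as [If Ef]; fold V s in If, Ef.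
    unfold X; rewrite Ef, <- LS_scal by apply IH.
    apply (LS_abs_le delta); [easy | easy | now apply LSI_scal |].
    intros t Ht; destruct (Hratio t Ht) as (Hj1 & Hj2 & Hj3).
    pose proof (Rdist_ge_1 n K _ w Hw Hj1 Hn1) as HR.
    rewrite logp_ln by easy; unfold H, Zn; fold V s.
    apply log_linearization; try easy; lra. }
  set (B := (e * Q) * (3 * TV)).
  assert (HeQ : 0 < e * Q) by now apply Rmult_lt_0_compat.
  assert (HE : forall K, (K0 <= K)%nat -> trunc_E p n K (fun w => Rabs (X w)) <= B).
  { intros K HK.
    eapply Rle_trans; [apply (trunc_E_le _ _ _ _ (fun w => (e * Q) * LS m a Da Ja (H w)) Hp (HX K))|].
    rewrite trunc_E_scal; apply Rmult_le_compat_l; [lra|].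
    destruct (LS_lsum m a Da Ja (wprob p) H (words n K) IH) as [I2 E2].
    unfold trunc_E; fold (lsum (fun w => wprob p w * LS m a Da Ja (H w)) (words n K)).
    rewrite E2.
    (* The constant 1 in [H] contributes at most 1, since the truncated mass is at most 1; [Zn ^ 2]
       contributes at most [(V + 1) / V <= 2]. *)
    apply Rle_trans with (LS m a Da Ja (fun _ => 3 * 1)).
    - apply (LS_le delta); auto; try (intros; apply Rabs_pos); try apply Iconst.
      intros t Ht; set (j := floorR (INR n * t)).
      assert (Hjn : (j <= n)%nat) by (apply floorR_le; lra).
      change (lsum (fun w => wprob p w * H w t) (words n K)) with (trunc_E p n K (fun w => H w t)).
      rewrite (trunc_E_ext _ _ _ _ (fun w => 1 + / V * (INR (Defs.Rdist j w) - ER p j) ^ 2)).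
      2:{ intros w _; unfold H, Zn; fold V s j; rewrite <- Hss; field; lra. }
      rewrite trunc_E_plus, trunc_E_one, trunc_E_scal.
      pose proof (dict_mass p K Hdict) as Hm.
      pose proof (pow_incr _ 1 n Hm) as Hm1; rewrite pow1 in Hm1.
      specialize (HK0 K HK j Hjn); pose proof (ER_le_mono p j n Hdict Hjn) as Hmono.
      fold V in Hmono.
      assert (/ V * trunc_E p n K (fun w => (INR (Defs.Rdist j w) - ER p j) ^ 2) <= 2); [|lra].
      rewrite Rmult_comm; apply Rle_div_l; lra.
    - rewrite LS_scal by apply Iconst; fold TV; lra. }
  assert (HB0 : 0 <= B) by (unfold B; nra).
  pose proof (Prob_markov p n K0 X eps B Hdict Heps HB0 HE) as HPr.
  unfold Rfunctions.Rdist; rewrite Rminus_0_r; unfold X in HPr; fold V s.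
  rewrite Rabs_right by lra.
  eapply Rle_lt_trans; [apply HPr|].
  apply Rlt_div_l; [easy|]; unfold B.
  assert (e * Q * TV <= e * Q * (TV + 1)) by (apply Rmult_le_compat_l; lra).
  assert (0 < eta * eps) by nra.
  lra.
Qed.
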